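(* Let $\overline{M}\times_F\widetilde{N}$ be the warped product manifold of a $1$-dimensional manifold $(\overline{M},\overline{g})$, $\overline{g}_{11}=\pm1$, and an $(n-1)$-dimensional quasi-Einstein conformally flat semi-Riemannian manifold $(\widetilde{N},\widetilde{g})$, $n\geq5$. Then on ${\mathcal U}_C\subset\overline{M}\times_F\widetilde{N}$ there are functions $L$ and $L_C$ such that $$R\cdot R-Q(S,R)=L\,Q(g,C),\qquad C\cdot C=L_C\,Q(g,C),$$ $$C\cdot R+R\cdot C=Q(S,C)+(L+L_C)\,Q(g,C)-\frac1{(n-2)^2}\,Q\Big(g,\frac{n-2}2\,S\wedge S-\kappa\,g\wedge S+g\wedge S^2\Big).$$
   Context: All manifolds are connected, paracompact and of class $C^\infty$. For a semi-Riemannian manifold $(M,g)$, $n=\dim M$, with Levi-Civita connection $\nabla$: ${\mathcal R}(X,Y)Z=\nabla_X\nabla_YZ-\nabla_Y\nabla_XZ-\nabla_{[X,Y]}Z$, $R(X_1,X_2,X_3,X_4)=g({\mathcal R}(X_1,X_2)X_3,X_4)$, $S(X,Y)=\mathrm{tr}\{Z\mapsto{\mathcal R}(Z,X)Y\}$, $g({\mathcal S}X,Y)=S(X,Y)$, $S^2(X,Y)=S({\mathcal S}X,Y)$, $\kappa=\mathrm{tr}\,{\mathcal S}$. For symmetric $(0,2)$-tensors $E,F$: $(E\wedge F)(X_1,X_2,X_3,X_4)=E(X_1,X_4)F(X_2,X_3)+E(X_2,X_3)F(X_1,X_4)-E(X_1,X_3)F(X_2,X_4)-E(X_2,X_4)F(X_1,X_3)$;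 $G=\frac12g\wedge g$; $C=R-\frac1{n-2}g\wedge S+\frac\kappa{(n-2)(n-1)}G$ is the Weyl tensor; a manifold of dimension $\geq4$ is conformally flat iff its Weyl tensor vanishes. For $B\in\{R,C\}$ define ${\mathcal B}$ by $g({\mathcal B}(X_1,X_2)X_3,X_4)=B(X_1,X_2,X_3,X_4)$; for a $(0,k)$-tensor $T$, $(B\cdot T)(X_1,\dots,X_k,X,Y)=-\sum_iT(X_1,\dots,{\mathcal B}(X,Y)X_i,\dots,X_k)$. For a symmetric $(0,2)$-tensor $A$, $(X\wedge_AY)Z=A(Y,Z)X-A(X,Z)Y$ and $Q(A,T)(X_1,\dots,X_k,X,Y)=-\sum_iT(X_1,\dots,(X\wedge_AY)X_i,\dots,X_k)$. ${\mathcal U}_S$ is the set of points where $S\ne\frac\kappa ng$; ${\mathcal U}_C$ is the set of points where $C\neq0$. A semi-Riemannian manifold $(M,g)$, $\dim M\ge3$, is quasi-Einstein if $\mathrm{rank}(S-\alpha g)=1$ on ${\mathcal U}_S$ for some function $\alpha$ on ${\mathcal U}_S$. Warped product: $F$ is a positive smooth function on $\overline M$ and $g=\pi_1^*\overline g+(F\circ\pi_1)\,\pi_2^*\widetilde g$ on $\overline M\times\widetilde N$. *)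

(* Defs.v *)
From HB Require Import structures.
From mathcomp Require Import all_boot all_order all_algebra.
From mathcomp Require Import boolp classical_sets functions cardinality.
From mathcomp Require Import reals topology normedtype landau derive.

Set Implicit Arguments.
Unset Strict Implicit.
Unset Printing Implicit Defensive.

Import Order.TTheory GRing.Theory Num.Theory.
Import numFieldNormedType.Exports.

Local Open Scope classical_set_scope.
Local Open Scope ring_scope.

Section Smooth.
Context {R : realType}.

Definition iter_derive n (vs : seq 'rV[R]_n) (f : 'rV[R]_n -> R) :=
  foldr (fun v h x => 'D_v h x) f vs.

(* C^oo on an open set [U]. *)
Definition smooth_on n (U : set 'rV[R]_n) (f : 'rV[R]_n -> R) :=
  forall vs x, U x -> differentiable (iter_derive vs f) x.

Lemma smooth_on_diff n (U : set 'rV[R]_n) f x :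
  smooth_on U f -> U x -> differentiable f x.
Proof. by move=> /(_ [::]); apply. Qed.

Lemma smooth_on_derive n (U : set 'rV[R]_n) f v :
  smooth_on U f -> smooth_on U (fun x => 'D_v f x).
Proof.
move=> sf vs x Ux; have := sf (rcons vs v) x Ux.
by rewrite /iter_derive foldr_rcons.
Qed.

Lemma smooth_on_cst n (U : set 'rV[R]_n) (c : R) : smooth_on U (cst c).
Proof.
move=> vs x _; suff [d ->] : exists d, iter_derive vs (cst c) = cst d.
  exact: differentiable_cst.
elim: vs => [|v vs [d /= ->]]; first by exists c.
by exists 0; apply/funext => y; rewrite derive_cst.
Qed.

Lemma near_eq_differentiable (V W : normedModType R) (f h : V -> W) (x : V) :
  {near x, f =1 h} -> differentiable f x -> differentiable h x.
Proof.
move=> fh /diff_locallyP [dc df].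
have dh : h \o shift x = cst (h x) + 'd f x +o_ 0 id.
  apply/eqaddoP => e e0; move/eqaddoP : df => /(_ e e0).
  have fh0 : \forall y \near 0, f (y + x) = h (y + x).
    by move: fh; rewrite [X in X -> _](near_shift 0) /= subr0.
  apply: filterS2 fh0 => y fhy; congr (_ <= _).
  by rewrite /= !fctE /= fhy (nbhs_singleton fh).
have dE := diff_unique dc dh.
by apply/diff_locallyP; rewrite dE.
Qed.

(* Sums of products of a smooth function of the first block of coordinates and
   a smooth function of the second block; this class is stable under
   differentiation. *)
Inductive split_smooth p q (U : set 'rV[R]_p) (V : set 'rV[R]_q) :
    ('rV[R]_(p + q) -> R) -> Prop :=
  | SplitMul f h of smooth_on U f & smooth_on V h :
      split_smooth U V (fun z => f (lsubmx z) * h (rsubmx z))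
  | SplitAdd a b of split_smooth U V a & split_smooth U V b :
      split_smooth U V (fun z => a z + b z).

Lemma derive_comp_lsubmx p q (W : normedModType R) (f : 'rV[R]_p -> W) v z :
  'D_v (fun z : 'rV[R]_(p + q) => f (lsubmx z)) z = 'D_(lsubmx v) f (lsubmx z).
Proof.
rewrite /derive; have -> // : (fun t : R => t^-1 *:
    (((fun z => f (lsubmx z)) \o shift z) (t *: v) - f (lsubmx z))) =
  (fun t : R => t^-1 *:
    ((f \o shift (lsubmx z)) (t *: lsubmx v) - f (lsubmx z))).
by apply/funext => t /=; rewrite linearP.
Qed.

Lemma derive_comp_rsubmx p q (W : normedModType R) (f : 'rV[R]_q -> W) v z :
  'D_v (fun z : 'rV[R]_(p + q) => f (rsubmx z)) z = 'D_(rsubmx v) f (rsubmx z).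
Proof.
rewrite /derive; have -> // : (fun t : R => t^-1 *:
    (((fun z => f (rsubmx z)) \o shift z) (t *: v) - f (rsubmx z))) =
  (fun t : R => t^-1 *:
    ((f \o shift (rsubmx z)) (t *: rsubmx v) - f (rsubmx z))).
by apply/funext => t /=; rewrite linearP.
Qed.

Lemma split_smooth_derive p q (U : set 'rV[R]_p) (V : set 'rV[R]_q) a :
  split_smooth U V a ->
  (forall z, U (lsubmx z) -> V (rsubmx z) -> differentiable a z) /\
  forall v, exists2 b, split_smooth U V b &
    forall z, U (lsubmx z) -> V (rsubmx z) -> 'D_v a z = b z.
Proof.
elim=> {a} [f h sf sh|a b _ [da Da] _ [db Db]].
  have dl (z : 'rV_(p + q)) : U (lsubmx z) -> differentiable (fun z => f (lsubmx z)) z.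
    move=> Uz; apply: (differentiable_comp (differentiable_lsubmx z)).
    exact: smooth_on_diff sf Uz.
  have dr (z : 'rV_(p + q)) : V (rsubmx z) -> differentiable (fun z => h (rsubmx z)) z.
    move=> Vz; apply: (differentiable_comp (differentiable_rsubmx z)).
    exact: smooth_on_diff sh Vz.
  split=> [z Uz Vz|v].
    exact: (differentiableM (dl z Uz) (dr z Vz)).
  exists (fun z => f (lsubmx z) * 'D_(rsubmx v) h (rsubmx z) +
                   'D_(lsubmx v) f (lsubmx z) * h (rsubmx z)).
    apply: SplitAdd.
      by apply: (SplitMul (h := fun y => 'D_(rsubmx v) h y)) => //;
        exact: smooth_on_derive.
    by apply: (SplitMul (f := fun y => 'D_(lsubmx v) f y)) => //;
      exact: smooth_on_derive.
  move=> z Uz Vz.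
  have := deriveM (@diff_derivable _ _ _ _ _ v (dl z Uz)) (@diff_derivable _ _ _ _ _ v (dr z Vz)).
  rewrite derive_comp_lsubmx derive_comp_rsubmx => ->.
  by rewrite /GRing.scale /= [h _ * _]mulrC.
split=> [z Uz Vz|v]; first exact: (differentiableD (da z Uz Vz) (db z Uz Vz)).
have [a' sa' aE] := Da v; have [b' sb' bE] := Db v.
exists (fun z => a' z + b' z); first exact: SplitAdd.
move=> z Uz Vz; rewrite -aE // -bE //.
exact: (deriveD (@diff_derivable _ _ _ _ _ v (da z Uz Vz)) (@diff_derivable _ _ _ _ _ v (db z Uz Vz))).
Qed.

Definition split_set p q (U : set 'rV[R]_p) (V : set 'rV[R]_q) :
  set 'rV[R]_(p + q) := [set z | U (lsubmx z) /\ V (rsubmx z)].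

Lemma open_split_set p q (U : set 'rV[R]_p) (V : set 'rV[R]_q) :
  open U -> open V -> open (split_set U V).
Proof.
move=> oU oV; apply: openI.
  by apply: open_comp oU => z _; apply: continuous_lsubmx.
by apply: open_comp oV => z _; apply: continuous_rsubmx.
Qed.

Lemma split_smooth_on p q (U : set 'rV[R]_p) (V : set 'rV[R]_q) a :
  open U -> open V -> split_smooth U V a -> smooth_on (split_set U V) a.
Proof.
move=> oU oV sa vs.
have [b sb bE] : exists2 b, split_smooth U V b &
    forall z, split_set U V z -> iter_derive vs a z = b z.
  elim: vs => [|v vs [b sb bE]] /=; first by exists a.
  have [_ /(_ v) [c sc cE]] := split_smooth_derive sb.
  exists c => // z Wz; rewrite -cE; [|by case: Wz..].
  apply: near_eq_derive.
  apply: filterS (open_nbhs_nbhs (conj (open_split_set oU oV) Wz)).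
  by move=> y Wy; apply: bE.
move=> z Wz; apply: (@near_eq_differentiable _ _ b).
  apply: filterS (open_nbhs_nbhs (conj (open_split_set oU oV) Wz)).
  by move=> y Wy; rewrite bE.
by case: Wz => Uz Vz; exact: (split_smooth_derive sb).1.
Qed.

Lemma smooth_on_lsubmx p q (U : set 'rV[R]_p) (V : set 'rV[R]_q) f :
  open U -> open V -> smooth_on U f ->
  smooth_on (split_set U V) (fun z => f (lsubmx z)).
Proof.
move=> oU oV sf; rewrite (_ : (fun z => _) =
  fun z : 'rV[R]_(p + q) => f (lsubmx z) * cst 1 (rsubmx z)); last first.
  by apply/funext => z; rewrite /= mulr1.
by apply: split_smooth_on => //; constructor => //; apply: smooth_on_cst.
Qed.

Lemma smooth_on_rsubmx p q (U : set 'rV[R]_p) (V : set 'rV[R]_q) f :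
  open U -> open V -> smooth_on V f ->
  smooth_on (split_set U V) (fun z => f (rsubmx z)).
Proof.
move=> oU oV sf; rewrite (_ : (fun z => _) =
  fun z : 'rV[R]_(p + q) => cst 1 (lsubmx z) * f (rsubmx z)); last first.
  by apply/funext => z; rewrite /= mul1r.
by apply: split_smooth_on => //; constructor => //; apply: smooth_on_cst.
Qed.

End Smooth.

(* [chart_inv] is total; its values outside [chart_cod] are irrelevant. *)
Record chart (R : realType) (T : topologicalType) (n : nat) := Chart {
  chart_dom : set T;
  chart_cod : set 'rV[R]_n;
  chart_map : T -> 'rV[R]_n;
  chart_inv : 'rV[R]_n -> T;
  chart_dom_open : open chart_dom;
  chart_cod_open : open chart_cod;
  chart_mapP : forall p, chart_dom p -> chart_cod (chart_map p);
  chart_invP : forall x, chart_cod x -> chart_dom (chart_inv x);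
  chart_mapK : forall p, chart_dom p -> chart_inv (chart_map p) = p;
  chart_invK : forall x, chart_cod x -> chart_map (chart_inv x) = x;
  chart_map_cont : forall p, chart_dom p -> {for p, continuous chart_map};
  chart_inv_cont : forall x, chart_cod x -> {for x, continuous chart_inv}
}.

Section Transition.
Context {R : realType} {T : topologicalType} {n : nat}.
Implicit Types c d : chart R T n.

Definition transition c d (x : 'rV[R]_n) := chart_map d (chart_inv c x).

Definition overlap c d : set 'rV[R]_n :=
  [set x | chart_cod c x /\ chart_dom d (chart_inv c x)].

Lemma overlap_open c d : open (overlap c d).
Proof.
rewrite openE => x [cx dx]; apply: filterI.
  exact: open_nbhs_nbhs (conj (@chart_cod_open _ _ _ c) cx).
apply: (chart_inv_cont cx).
exact: open_nbhs_nbhs (conj (@chart_dom_open _ _ _ d) dx).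
Qed.

End Transition.

(* A C^oo atlas, with a chosen chart around each point. The tangent space at p
   is R^n, read in the chosen chart [base_chart p]; a tensor at p is a
   multilinear map on it. *)
Record manifold (R : realType) (n : nat) := Manifold {
  space :> topologicalType;
  chart_index : Type;
  atlas : chart_index -> chart R space n;
  base_chart : space -> chart_index;
  base_chartP : forall p, chart_dom (atlas (base_chart p)) p;
  atlas_smooth : forall i j k, smooth_on (overlap (atlas i) (atlas j))
    (fun x => transition (atlas i) (atlas j) x 0 k)
}.

Arguments atlas {R n} m _.
Arguments base_chart {R n} m _.

Definition locally_finite (T : topologicalType) (C : set (set T)) :=
  forall p : T, exists2 W, nbhs p W & finite_set [set A | C A /\ A `&` W !=set0].

Definition paracompact (T : topologicalType) :=
  forall C : set (set T),
    (forall A, C A -> open A) -> \bigcup_(A in C) A = setT ->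
  exists D : set (set T),
    [/\ forall A, D A -> open A, \bigcup_(A in D) A = setT,
        (forall A, D A -> exists2 B, C B & A `<=` B) & locally_finite D].

Definition connected_paracompact (T : topologicalType) :=
  [/\ connected [set: T], hausdorff_space T & paracompact T].

Definition smooth_function (R : realType) n (M : manifold R n) (f : M -> R) :=
  forall i, smooth_on (chart_cod (atlas M i))
    (fun x => f (chart_inv (atlas M i) x)).

Definition form2 (R : realType) n := 'rV[R]_n -> 'rV[R]_n -> R.
Definition form4 (R : realType) n :=
  'rV[R]_n -> 'rV[R]_n -> 'rV[R]_n -> 'rV[R]_n -> R.
Definition form6 (R : realType) n :=
  'rV[R]_n -> 'rV[R]_n -> 'rV[R]_n -> 'rV[R]_n -> 'rV[R]_n -> 'rV[R]_n -> R.

Definition gram_form (R : realType) n (g : 'M[R]_n) : form2 R n :=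
  fun X Y => (X *m g *m Y^T) 0 0.

(* The index is not mentioned: on a connected manifold it is constant. *)
Record semiRiemannian (R : realType) (n : nat) := SemiRiemannian {
  underlying :> manifold R n;
  metric : chart_index underlying -> 'rV[R]_n -> 'M[R]_n;
  metric_smooth : forall i k l, smooth_on (chart_cod (atlas underlying i))
    (fun x => metric i x k l);
  metric_sym : forall i x, chart_cod (atlas underlying i) x ->
    (metric i x)^T = metric i x;
  metric_nondegenerate : forall i x, chart_cod (atlas underlying i) x ->
    metric i x \in unitmx;
  metric_compat : forall i j x X Y,
    let tau := transition (atlas underlying i) (atlas underlying j) in
    overlap (atlas underlying i) (atlas underlying j) x ->
    gram_form (metric i x) X Y =
    gram_form (metric j (tau x)) ('D_X tau x) ('D_Y tau x)
}.

Arguments metric {R n} s _ _.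

(* Algebra on one tangent space; [g] is the Gram matrix of the metric there. *)
Section TensorAlgebra.
Context {R : realType} {n : nat}.
Local Notation V := 'rV[R]_n.
Implicit Types (g : 'M[R]_n) (A E F : form2 R n) (B T : form4 R n).

(* The vector v such that g(v, w) = a(w) for all w. *)
Definition sharp g (a : V -> R) : V :=
  (\row_j a (delta_mx 0 j)) *m invmx g.

Definition endo_trace (f : V -> V) : R := \tr (lin1_mx f).

Definition form2_mx A : 'M[R]_n :=
  \matrix_(i, j) A (delta_mx 0 i) (delta_mx 0 j).

Definition kulkarni E F : form4 R n := fun X1 X2 X3 X4 =>
  E X1 X4 * F X2 X3 + E X2 X3 * F X1 X4
  - E X1 X3 * F X2 X4 - E X2 X4 * F X1 X3.

Definition form_op g B (X Y Z : V) : V := sharp g (B X Y Z).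

Definition wedge_op A (X Y Z : V) : V := A Y Z *: X - A X Z *: Y.

Definition derivation_act (D : V -> V -> V -> V) T : form6 R n :=
  fun X1 X2 X3 X4 X Y =>
  - (T (D X Y X1) X2 X3 X4 + T X1 (D X Y X2) X3 X4
     + T X1 X2 (D X Y X3) X4 + T X1 X2 X3 (D X Y X4)).

(* B . T *)
Definition dot g B T : form6 R n := derivation_act (form_op g B) T.

(* Q(A, T) *)
Definition tachibana A T : form6 R n := derivation_act (wedge_op A) T.

End TensorAlgebra.

(* [G] is a metric in coordinates on an open subset of R^n; the Levi-Civita
   connection acts on vector fields written in these coordinates. *)
Section LocalGeometry.
Context {R : realType} {n : nat}.
Variable G : 'rV[R]_n -> 'M[R]_n.
Local Notation V := 'rV[R]_n.
Implicit Types (X Y Z : V -> V) (x u v w : V).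

(* Koszul's formula for coordinate-constant fields, whose brackets vanish. *)
Definition christoffel x u v : V := sharp (G x) (fun w =>
  2^-1 * ('D_u (fun y => gram_form (G y) v w) x
          + 'D_v (fun y => gram_form (G y) u w) x
          - 'D_w (fun y => gram_form (G y) u v) x)).

Definition nabla X Y : V -> V :=
  fun x => 'D_(X x) Y x + christoffel x (X x) (Y x).

Definition lie_bracket X Y : V -> V :=
  fun x => 'D_(X x) Y x - 'D_(Y x) X x.

Definition curvature X Y Z : V -> V := fun x =>
  nabla X (nabla Y Z) x - nabla Y (nabla X Z) x - nabla (lie_bracket X Y) Z x.

(* The curvature is tensorial, so it may be computed on constant extensions. *)
Definition curvature_at x u v w : V := curvature (cst u) (cst v) (cst w) x.

End LocalGeometry.

Section Curvature.
Context {R : realType} {n : nat}.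
Variables (M : semiRiemannian R n) (p : M).
Local Notation V := 'rV[R]_n.
Local Notation c := (base_chart M p).

Definition coord : V := chart_map (atlas M c) p.

Definition gram : 'M[R]_n := metric M c coord.

Definition metric_form : form2 R n := gram_form gram.

Definition riemann_op (X Y Z : V) : V := curvature_at (metric M c) coord X Y Z.

Definition riemann : form4 R n := fun X1 X2 X3 X4 =>
  metric_form (riemann_op X1 X2 X3) X4.

Definition ricci : form2 R n := fun X Y =>
  endo_trace (fun Z => riemann_op Z X Y).

Definition ricci_op (X : V) : V := sharp gram (ricci X).

Definition ricci2 : form2 R n := fun X Y => ricci (ricci_op X) Y.

Definition scalar_curvature : R := endo_trace ricci_op.

Definition metric_G : form4 R n := fun X1 X2 X3 X4 =>
  2^-1 * kulkarni metric_form metric_form X1 X2 X3 X4.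

Definition weyl : form4 R n := fun X1 X2 X3 X4 =>
  riemann X1 X2 X3 X4
  - (n%:R - 2)^-1 * kulkarni metric_form ricci X1 X2 X3 X4
  + scalar_curvature / ((n%:R - 2) * (n%:R - 1)) * metric_G X1 X2 X3 X4.

End Curvature.

Section Classes.
Context {R : realType} {n : nat}.
Variable M : semiRiemannian R n.

Definition ricci_support : set M := [set p | exists X Y,
  ricci p X Y <> scalar_curvature p / n%:R * metric_form p X Y].

Definition weyl_support : set M := [set p | exists X1 X2 X3 X4,
  weyl p X1 X2 X3 X4 <> 0].

Definition quasi_einstein := exists alpha : M -> R,
  forall p, ricci_support p ->
    \rank (form2_mx (ricci p) - alpha p *: gram p) = 1%N.

(* The Weyl tensor characterizes conformal flatness in dimension at least 4. *)
Definition conformally_flat := forall (p : M) X1 X2 X3 X4,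
  weyl p X1 X2 X3 X4 = 0.

End Classes.

Arguments ricci_support {R n} M _.
Arguments weyl_support {R n} M _.

Section ProductChart.
Context {R : realType} {T U : topologicalType} {p q : nat}.
Variables (c : chart R T p) (d : chart R U q).

Let dom : set (T * U) := [set z | chart_dom c z.1 /\ chart_dom d z.2].
Let cod : set 'rV[R]_(p + q) := split_set (chart_cod c) (chart_cod d).
Let map (z : T * U) : 'rV[R]_(p + q) :=
  row_mx (chart_map c z.1) (chart_map d z.2).
Let inv (x : 'rV[R]_(p + q)) : T * U :=
  (chart_inv c (lsubmx x), chart_inv d (rsubmx x)).

Fact prod_dom_open : open dom.
Proof.
rewrite openE => -[a b] [/= ca db].
exists (chart_dom c, chart_dom d) => //=; split.
  exact: open_nbhs_nbhs (conj (@chart_dom_open _ _ _ c) ca).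
exact: open_nbhs_nbhs (conj (@chart_dom_open _ _ _ d) db).
Qed.

Fact prod_cod_open : open cod.
Proof. by apply: open_split_set; apply: chart_cod_open. Qed.

Fact prod_mapP z : dom z -> cod (map z).
Proof.
by case=> cz dz; split; rewrite /= ?row_mxKl ?row_mxKr; apply: chart_mapP.
Qed.

Fact prod_invP x : cod x -> dom (inv x).
Proof. by case=> cx dx; split; apply: chart_invP. Qed.

Fact prod_mapK z : dom z -> inv (map z) = z.
Proof.
case: z => a b [/= ca db].
by rewrite /inv /map row_mxKl row_mxKr !chart_mapK.
Qed.

Fact prod_invK x : cod x -> map (inv x) = x.
Proof. by case=> cx dx; rewrite /map /= !chart_invK // hsubmxK. Qed.

Fact prod_map_cont z : dom z -> {for z, continuous map}.
Proof.
case: z => a b [/= ca db] A [P nP sPA].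
have ncP : nbhs a [set a' | forall j, P 0 (lshift q j) (chart_map c a' 0 j)].
  apply: filter_forall => j.
  have : {for a, continuous (fun a' => chart_map c a' 0 j)}.
    exact: (cvg_comp _ _ (chart_map_cont ca)
      (@coord_continuous _ _ _ 0 j (chart_map c a))).
  by apply; have := nP 0 (lshift q j); rewrite /map row_mxEl.
have ndP : nbhs b [set b' | forall j, P 0 (rshift p j) (chart_map d b' 0 j)].
  apply: filter_forall => j.
  have : {for b, continuous (fun b' => chart_map d b' 0 j)}.
    exact: (cvg_comp _ _ (chart_map_cont db)
      (@coord_continuous _ _ _ 0 j (chart_map d b))).
  by apply; have := nP 0 (rshift p j); rewrite /map row_mxEr.
exists ([set a' | forall j, P 0 (lshift q j) (chart_map c a' 0 j)],
        [set b' | forall j, P 0 (rshift p j) (chart_map d b' 0 j)]) => //=.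
move=> [a' b'] [/= Pa' Pb']; apply: sPA => i k; rewrite ord1 /map /=.
by case: (split_ordP k) => j ->; rewrite ?row_mxEl ?row_mxEr.
Qed.

Fact prod_inv_cont x : cod x -> {for x, continuous inv}.
Proof.
case=> cx dx A [[P Q] [/= nP nQ] sPQA].
have nP' : nbhs x [set y | P (chart_inv c (lsubmx y))].
  exact: (cvg_comp _ _ (@continuous_lsubmx _ _ _ _ x) (chart_inv_cont cx) P nP).
have nQ' : nbhs x [set y | Q (chart_inv d (rsubmx y))].
  exact: (cvg_comp _ _ (@continuous_rsubmx _ _ _ _ x) (chart_inv_cont dx) Q nQ).
suff : nbhs x (inv @^-1` A) by [].
by apply: filterS (filterI nP' nQ') => y [Py Qy]; apply: sPQA.
Qed.

Definition prod_chart : chart R (T * U)%type (p + q) :=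
  Chart prod_dom_open prod_cod_open prod_mapP prod_invP prod_mapK prod_invK
    prod_map_cont prod_inv_cont.

End ProductChart.

Section ProductManifold.
Context {R : realType} {p q : nat}.
Variables (M : manifold R p) (N : manifold R q).

Definition prod_atlas (i : chart_index M * chart_index N) :=
  prod_chart (atlas M i.1) (atlas N i.2).

Definition prod_base_chart (z : M * N) := (base_chart M z.1, base_chart N z.2).

Fact prod_base_chartP z : chart_dom (prod_atlas (prod_base_chart z)) z.
Proof. by split; apply: base_chartP. Qed.

Lemma prod_overlap i j : overlap (prod_atlas i) (prod_atlas j) =
  split_set (overlap (atlas M i.1) (atlas M j.1))
            (overlap (atlas N i.2) (atlas N j.2)).
Proof.
by apply/seteqP; split=> z [[? ?] [? ?]]; do ![split].
Qed.

Lemma prod_transition i j z : transition (prod_atlas i) (prod_atlas j) z =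
  row_mx (transition (atlas M i.1) (atlas M j.1) (lsubmx z))
         (transition (atlas N i.2) (atlas N j.2) (rsubmx z)).
Proof. by []. Qed.

Fact prod_atlas_smooth i j k :
  smooth_on (overlap (prod_atlas i) (prod_atlas j))
    (fun x => transition (prod_atlas i) (prod_atlas j) x 0 k).
Proof.
rewrite prod_overlap; case: (split_ordP k) => l ->.
  rewrite (_ : (fun x => _) = fun x : 'rV_(p + q) =>
    transition (atlas M i.1) (atlas M j.1) (lsubmx x) 0 l).
    apply: (smooth_on_lsubmx (f := fun x =>
      transition (atlas M i.1) (atlas M j.1) x 0 l)); [exact: overlap_open..|].
    exact: atlas_smooth.
  by apply/funext => x; rewrite prod_transition row_mxEl.
rewrite (_ : (fun x => _) = fun x : 'rV_(p + q) =>
  transition (atlas N i.2) (atlas N j.2) (rsubmx x) 0 l).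
  apply: (smooth_on_rsubmx (f := fun x =>
    transition (atlas N i.2) (atlas N j.2) x 0 l)); [exact: overlap_open..|].
  exact: atlas_smooth.
by apply/funext => x; rewrite prod_transition row_mxEr.
Qed.

Definition prod_manifold : manifold R (p + q) :=
  Manifold prod_base_chartP prod_atlas_smooth.

End ProductManifold.

Section WarpedProduct.
Context {R : realType} {p q : nat}.
Variables (M : semiRiemannian R p) (N : semiRiemannian R q) (F : M -> R).
Hypotheses (F_smooth : smooth_function F) (F_gt0 : forall a, 0 < F a).
Local Notation MN := (prod_manifold M N).

Definition warped_metric (i : chart_index MN) (z : 'rV[R]_(p + q)) :
  'M[R]_(p + q) :=
  block_mx (metric M i.1 (lsubmx z)) 0 0
    (F (chart_inv (atlas M i.1) (lsubmx z)) *: metric N i.2 (rsubmx z)).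

Fact warped_metric_smooth i k l : smooth_on (chart_cod (atlas MN i))
  (fun x => warped_metric i x k l).
Proof.
have oc := @chart_cod_open _ _ _ (atlas M i.1).
have od := @chart_cod_open _ _ _ (atlas N i.2).
case: (split_ordP k) => k' ->; case: (split_ordP l) => l' ->.
- rewrite (_ : (fun x => _) = fun x => metric M i.1 (lsubmx x) k' l').
    by apply: (smooth_on_lsubmx (f := fun x => metric M i.1 x k' l')) => //;
      apply: metric_smooth.
  by apply/funext => x; rewrite /warped_metric block_mxEul.
- rewrite (_ : (fun x => _) = cst 0); first exact: smooth_on_cst.
  by apply/funext => x; rewrite /warped_metric block_mxEur mxE.
- rewrite (_ : (fun x => _) = cst 0); first exact: smooth_on_cst.
  by apply/funext => x; rewrite /warped_metric block_mxEdl mxE.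
- rewrite (_ : (fun x => _) = fun x : 'rV_(p + q) =>
    F (chart_inv (atlas M i.1) (lsubmx x)) * metric N i.2 (rsubmx x) k' l').
    apply: split_smooth_on => //.
    apply: (SplitMul (f := fun x => F (chart_inv (atlas M i.1) x))
                     (h := fun x => metric N i.2 x k' l')) => //.
    exact: metric_smooth.
  by apply/funext => x; rewrite /warped_metric block_mxEdr mxE.
Qed.

Fact warped_metric_sym i x : chart_cod (atlas MN i) x ->
  (warped_metric i x)^T = warped_metric i x.
Proof.
case=> cx dx; rewrite /warped_metric tr_block_mx !trmx0 linearZ /=.
by rewrite !metric_sym.
Qed.

Fact warped_metric_nondegenerate i x : chart_cod (atlas MN i) x ->
  warped_metric i x \in unitmx.
Proof.
case=> cx dx; rewrite unitmxE det_ublock detZ !unitrM.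
have := metric_nondegenerate cx; rewrite unitmxE => ->.
have := metric_nondegenerate dx; rewrite unitmxE => ->.
by rewrite unitrX // unitfE gt_eqF.
Qed.

Lemma gram_form_warped i z X Y : gram_form (warped_metric i z) X Y =
  gram_form (metric M i.1 (lsubmx z)) (lsubmx X) (lsubmx Y) +
  F (chart_inv (atlas M i.1) (lsubmx z)) *
    gram_form (metric N i.2 (rsubmx z)) (rsubmx X) (rsubmx Y).
Proof.
rewrite /gram_form /warped_metric -{1}[X]hsubmxK -{1}[Y]hsubmxK.
rewrite mul_row_block !mulmx0 addr0 add0r tr_row_mx mul_row_col mxE.
by congr (_ + _); rewrite -scalemxAr -scalemxAl mxE.
Qed.

Lemma gram_form_warped_row i x y u v u' v' :
  gram_form (warped_metric i (row_mx x y)) (row_mx u v) (row_mx u' v') =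
  gram_form (metric M i.1 x) u u' +
  F (chart_inv (atlas M i.1) x) * gram_form (metric N i.2 y) v v'.
Proof. by rewrite gram_form_warped !row_mxKl !row_mxKr. Qed.

Lemma derive_coord (m n : nat) (f : 'rV[R]_m -> 'rV[R]_n) (U : set 'rV[R]_m)
    x v : (forall k, smooth_on U (fun y => f y 0 k)) -> U x ->
  'D_v f x = \row_k 'D_v (fun y => f y 0 k) x.
Proof.
move=> sf Ux; rewrite derive_mx.
  by apply/rowP => k; rewrite !mxE.
apply/derivable_mxP => i k; rewrite ord1; apply: diff_derivable.
exact: smooth_on_diff (sf k) Ux.
Qed.

Fact warped_metric_compat i j x X Y :
  let tau := transition (atlas MN i) (atlas MN j) in
  overlap (atlas MN i) (atlas MN j) x ->
  gram_form (warped_metric i x) X Y =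
  gram_form (warped_metric j (tau x)) ('D_X tau x) ('D_Y tau x).
Proof.
move=> tau ox; have := ox; rewrite prod_overlap => -[oM oN].
have DE Z : 'D_Z tau x = row_mx
    ('D_(lsubmx Z) (transition (atlas M i.1) (atlas M j.1)) (lsubmx x))
    ('D_(rsubmx Z) (transition (atlas N i.2) (atlas N j.2)) (rsubmx x)).
  have tauE y : tau y = row_mx
      (transition (atlas M i.1) (atlas M j.1) (lsubmx y))
      (transition (atlas N i.2) (atlas N j.2) (rsubmx y)) := prod_transition i j y.
  have := derive_coord Z (fun k => @atlas_smooth _ _ MN i j k) ox.
  rewrite -/tau => ->.
  have -> := derive_coord (lsubmx Z)
    (fun k => @atlas_smooth _ _ M i.1 j.1 k) oM.
  have -> := derive_coord (rsubmx Z)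
    (fun k => @atlas_smooth _ _ N i.2 j.2 k) oN.
  apply/rowP => k; rewrite [LHS]mxE; case: (split_ordP k) => l ->.
    rewrite row_mxEl [RHS]mxE.
    pose f w := transition (atlas M i.1) (atlas M j.1) w 0 l.
    have -> : (fun y => tau y 0 (lshift q l)) = (fun y => f (lsubmx y)).
      by apply/funext => y; rewrite tauE row_mxEl.
    exact: (derive_comp_lsubmx f Z x).
  rewrite row_mxEr [RHS]mxE.
  pose f w := transition (atlas N i.2) (atlas N j.2) w 0 l.
  have -> : (fun y => tau y 0 (rshift p l)) = (fun y => f (rsubmx y)).
    by apply/funext => y; rewrite tauE row_mxEr.
  exact: (derive_comp_rsubmx f Z x).
have tE : tau x = row_mx (transition (atlas M i.1) (atlas M j.1) (lsubmx x))
    (transition (atlas N i.2) (atlas N j.2) (rsubmx x)) := prod_transition i j x.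
have [eX eY] := (DE X, DE Y); move: eX eY tE {DE}.
move: ('D_X tau x) ('D_Y tau x) (tau x) => X' Y' x' -> -> ->.
rewrite [LHS]gram_form_warped [RHS]gram_form_warped_row.
rewrite (metric_compat _ _ oM) (metric_compat _ _ oN).
by rewrite /transition chart_mapK //; case: oM.
Qed.

Definition warped_product : semiRiemannian R (p + q) :=
  SemiRiemannian warped_metric_smooth warped_metric_sym
    warped_metric_nondegenerate warped_metric_compat.

End WarpedProduct.

(* Main.v *)
Require Import Defs.
From HB Require Import structures.
From mathcomp Require Import all_boot all_order all_algebra.
From mathcomp Require Import boolp classical_sets functions cardinality.
From mathcomp Require Import reals topology normedtype landau derive.
From mathcomp Require Import ring.

Set Implicit Arguments.
Unset Strict Implicit.
Unset Printing Implicit Defensive.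

Import Order.TTheory GRing.Theory Num.Theory.
Import numFieldNormedType.Exports.

Local Open Scope classical_set_scope.
Local Open Scope ring_scope.

(* At each point the curvature tensor of the warped product is a combination of
   g /\ g, g /\ (eta (x) eta), g /\ (w (x) w) and (eta (x) eta) /\ (w (x) w),
   where eta is the covector of the base and w comes from the rank one part of
   the Ricci tensor of the fibre: conformal flatness expresses the curvature of
   the fibre through its metric and Ricci tensors, and warping adds only terms
   g /\ g and g /\ (eta (x) eta).  Relative to the first three coefficients
   a, b, c, the last one is - e c with e = g(eta, eta), so the Ricci and Weyl
   tensors lie in the same families, all the tensors R.R, Q(S,R), C.C, ... are
   combinations of five fixed tensors of type (0,6), and comparing coefficients
   gives L = - (n - 2) (2 a + e b) and
   L_C = (n - 3) c g(w,w) / ((n - 1) (n - 2)). *)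

(** * Curvature-like tensors built from two covectors *)

Section GramForm.
Context {R : realType} {n : nat} (g : 'M[R]_n).
Implicit Types x y z : 'rV[R]_n.

Lemma gram_formDl x y z : gram_form g (x + y) z = gram_form g x z + gram_form g y z.
Proof. by rewrite /gram_form !mulmxDl mxE. Qed.

Lemma gram_formZl k x z : gram_form g (k *: x) z = k * gram_form g x z.
Proof. by rewrite /gram_form -!scalemxAl mxE. Qed.

Lemma gram_formDr x y z : gram_form g z (x + y) = gram_form g z x + gram_form g z y.
Proof. by rewrite /gram_form linearD mulmxDr mxE. Qed.

Lemma gram_formZr k x z : gram_form g z (k *: x) = k * gram_form g z x.
Proof. by rewrite /gram_form linearZ -scalemxAr mxE. Qed.

Lemma gram_formNl x z : gram_form g (- x) z = - gram_form g x z.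
Proof. by rewrite -scaleN1r gram_formZl mulN1r. Qed.

Lemma gram_formNr x z : gram_form g z (- x) = - gram_form g z x.
Proof. by rewrite -scaleN1r gram_formZr mulN1r. Qed.

Lemma gram_form0l z : gram_form g 0 z = 0.
Proof. by rewrite -(scale0r 0) gram_formZl mul0r. Qed.

Lemma gram_form0r z : gram_form g z 0 = 0.
Proof. by rewrite -(scale0r 0) gram_formZr mul0r. Qed.

Definition gram_formE :=
  (gram_formDl, gram_formDr, gram_formZl, gram_formZr, gram_formNl, gram_formNr,
   gram_form0l, gram_form0r).

Lemma gram_formC x y : g^T = g -> gram_form g x y = gram_form g y x.
Proof.
move=> gT; rewrite /gram_form (_ : _ 0 0 = (x *m g *m y^T)^T 0 0); last by rewrite [RHS]mxE.
by rewrite !trmx_mul trmxK gT mulmxA.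
Qed.

Lemma gram_form_delta x j : gram_form g x (delta_mx 0 j) = (x *m g) 0 j.
Proof. by rewrite /gram_form trmx_delta -colE mxE. Qed.

Lemma sharp_gram x : g \in unitmx -> sharp g (gram_form g x) = x.
Proof.
move=> gU; rewrite /sharp (_ : \row__ _ = x *m g) ?mulmxK //.
by apply/rowP => j; rewrite mxE gram_form_delta.
Qed.

Lemma gram_form_inj x y : g \in unitmx ->
  (forall z, gram_form g x z = gram_form g y z) -> x = y.
Proof.
by move=> gU /funext xy; rewrite -(sharp_gram x gU) xy sharp_gram.
Qed.

End GramForm.

Section Trace.
Context {R : realType} {n : nat}.
Implicit Types (f h : 'rV[R]_n -> 'rV[R]_n) (x : 'rV[R]_n).

Lemma endo_traceE f : endo_trace f = \sum_i f (delta_mx 0 i) 0 i.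
Proof. by apply: eq_bigr => i _; rewrite mxE. Qed.

Lemma endo_traceD f h : endo_trace (fun z => f z + h z) = endo_trace f + endo_trace h.
Proof.
by rewrite !endo_traceE -big_split; apply: eq_bigr => i _; rewrite mxE.
Qed.

Lemma endo_traceZ k f : endo_trace (fun z => k *: f z) = k * endo_trace f.
Proof.
by rewrite !endo_traceE big_distrr; apply: eq_bigr => i _; rewrite mxE.
Qed.

Lemma endo_trace_id : endo_trace (fun z : 'rV[R]_n => z) = n%:R.
Proof.
rewrite endo_traceE (eq_bigr (fun=> 1)) => [|i _]; last by rewrite mxE !eqxx.
by rewrite sumr_const card_ord.
Qed.

Lemma endo_trace_rank1 (g : 'M[R]_n) x y :
  endo_trace (fun z => gram_form g x z *: y) = gram_form g x y.
Proof.
rewrite endo_traceE [RHS]mxE; apply: eq_bigr => i _.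
by rewrite mxE gram_form_delta [y^T _ _]mxE.
Qed.

End Trace.

Section Tensor.
Context {R : realType} {n : nat} (g : 'M[R]_n) (p q : 'rV[R]_n).
Local Notation V := 'rV[R]_n.
Local Notation "<< x , y >>" := (gram_form g x y).
Implicit Types X Y Z : V.

Definition sq_form (x : V) : form2 R n := fun X Y => <<x, X>> * <<x, Y>>.

(** The covectors eta and w of the overview are [<<p, .>>] and [<<q, .>>]. Since
    [kulkarni (gram_form g) (gram_form g)] is twice the tensor G, the first coefficient comes back
    as [2 * a] in the operators, traces and actions below. *)
Definition tens (a b c d : R) : form4 R n := fun X1 X2 X3 X4 =>
  a * kulkarni (gram_form g) (gram_form g) X1 X2 X3 X4
  + b * kulkarni (gram_form g) (sq_form p) X1 X2 X3 X4
  + c * kulkarni (gram_form g) (sq_form q) X1 X2 X3 X4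
  + d * kulkarni (sq_form p) (sq_form q) X1 X2 X3 X4.

Definition bform (s t u : R) : form2 R n := fun X Y =>
  s * <<X, Y>> + t * sq_form p X Y + u * sq_form q X Y.

(** [tens] with its last slot raised by [g]. The closed form turns traces and actions into
    polynomial identities. *)
Definition tens_op (a b c d : R) X Y Z : V :=
  (2 * a * <<Y, Z>> + b * sq_form p Y Z + c * sq_form q Y Z) *: X
  - (2 * a * <<X, Z>> + b * sq_form p X Z + c * sq_form q X Z) *: Y
  + (b * (<<Y, Z>> * <<p, X>> - <<X, Z>> * <<p, Y>>)
     + d * <<q, Z>> * (<<p, X>> * <<q, Y>> - <<p, Y>> * <<q, X>>)) *: p
  + (c * (<<Y, Z>> * <<q, X>> - <<X, Z>> * <<q, Y>>)
     + d * <<p, Z>> * (<<p, Y>> * <<q, X>> - <<p, X>> * <<q, Y>>)) *: q.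

Hypotheses (gT : g^T = g) (gU : g \in unitmx).

Lemma gram_tens_op a b c d X Y Z W :
  <<tens_op a b c d X Y Z, W>> = tens a b c d X Y Z W.
Proof. rewrite /tens_op /tens /kulkarni /sq_form !gram_formE; ring. Qed.

Lemma form_op_tens a b c d X Y Z :
  form_op g (tens a b c d) X Y Z = tens_op a b c d X Y Z.
Proof.
rewrite /form_op -[RHS](sharp_gram _ gU); congr sharp.
by apply/funext => W; rewrite gram_tens_op.
Qed.

Variables (e om : R).
Hypotheses (pp : <<p, p>> = e) (pq : <<p, q>> = 0) (qq : <<q, q>> = om).

Lemma endo_trace_tens a b c d X Y :
  endo_trace (fun Z => tens_op a b c d Z X Y) =
  bform (2 * (n%:R - 1) * a + e * b + om * c)
        ((n%:R - 2) * b + om * d) ((n%:R - 2) * c + e * d) X Y.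
Proof.
(* Each summand is a multiple of the identity or of a rank one map [<<x, Z>> *: y], whose trace is
   [<<x, y>>]. *)
pose f Z : V := (2 * a * <<X, Y>> + b * sq_form p X Y + c * sq_form q X Y) *: Z
  + (- (2 * a)) *: (<<Y, Z>> *: X) + (- b * <<p, Y>>) *: (<<p, Z>> *: X)
  + (- c * <<q, Y>>) *: (<<q, Z>> *: X)
  + (b * <<X, Y>> + d * sq_form q X Y) *: (<<p, Z>> *: p)
  + (- b * <<p, X>>) *: (<<Y, Z>> *: p)
  + (- d * <<q, Y>> * <<p, X>>) *: (<<q, Z>> *: p)
  + (c * <<X, Y>> + d * sq_form p X Y) *: (<<q, Z>> *: q)
  + (- c * <<q, X>>) *: (<<Y, Z>> *: q)
  + (- d * <<p, Y>> * <<q, X>>) *: (<<p, Z>> *: q).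
rewrite (_ : (fun Z => _) = f); last first.
  apply/funext => Z; apply/rowP => i; rewrite /f /tens_op /sq_form !mxE.
  by rewrite (gram_formC Z Y gT); ring.
rewrite /f !endo_traceD !endo_traceZ endo_trace_id !endo_trace_rank1.
rewrite pp pq qq (gram_formC q p gT) pq /bform /sq_form (gram_formC Y p gT).
rewrite (gram_formC Y q gT) (gram_formC Y X gT); ring.
Qed.

Definition bop s t u X : V := s *: X + (t * <<p, X>>) *: p + (u * <<q, X>>) *: q.

Lemma sharp_bform s t u X : sharp g (bform s t u X) = bop s t u X.
Proof.
rewrite -[RHS](sharp_gram _ gU); congr sharp; apply/funext => W.
rewrite /bop /bform /sq_form !gram_formE; ring.
Qed.

Lemma endo_trace_bform s t u :
  endo_trace (bop s t u) = s * n%:R + t * e + u * om.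
Proof.
rewrite (_ : bop s t u = fun X => s *: X + t *: (<<p, X>> *: p) + u *: (<<q, X>> *: q)).
  by rewrite !endo_traceD !endo_traceZ endo_trace_id !endo_trace_rank1 pp qq.
by apply/funext => X; rewrite /bop !scalerA.
Qed.

(** Orthogonality of [p] and [q] kills the cross terms, so the family is stable under this
    composition. Applied to the Ricci tensor, it gives [ricci2]. *)
Lemma bform_bop s t u X Y : bform s t u (bop s t u X) Y =
  bform (s ^+ 2) (2 * s * t + e * t ^+ 2) (2 * s * u + om * u ^+ 2) X Y.
Proof.
rewrite /bform /bop /sq_form !gram_formE pp pq qq (gram_formC q p gT) pq; ring.
Qed.

Lemma kulkarni_gram_bform s t u : kulkarni (gram_form g) (bform s t u) =
  tens s t u 0.
Proof.
do 4!apply/funext => ?; rewrite /kulkarni /tens /bform /kulkarni /sq_form; ring.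
Qed.

Lemma kulkarni_bform s t u : kulkarni (bform s t u) (bform s t u) =
  tens (s ^+ 2) (2 * s * t) (2 * s * u) (2 * t * u).
Proof.
do 4!apply/funext => ?; rewrite /kulkarni /tens /bform /kulkarni /sq_form; ring.
Qed.

(* The action of the rotation [X /\_g Y] on the square of the covector
   [g(x, .)]. *)
Definition rot (x X Y : V) : form2 R n := fun A B =>
  - ((<<Y, A>> * <<x, X>> - <<X, A>> * <<x, Y>>) * <<x, B>>
     + (<<Y, B>> * <<x, X>> - <<X, B>> * <<x, Y>>) * <<x, A>>).

(** Up to sign, the exterior product of the two covectors at [X], [Y], times their symmetric
    product. An infinitesimal rotation in the plane of [p] and [q] changes the square of either
    covector by a multiple of this form. *)
Definition mix (X Y : V) : form2 R n := fun A B =>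
  (<<p, Y>> * <<q, X>> - <<p, X>> * <<q, Y>>)
  * (<<p, A>> * <<q, B>> + <<q, A>> * <<p, B>>).

Definition act2 (D : V -> V -> V -> V) (E : form2 R n) X Y : form2 R n :=
  fun A B => - (E (D X Y A) B + E A (D X Y B)).

(** Leibniz rule; it reduces every action on [tens] to the actions on [gram_form g], [sq_form p] and
    [sq_form q]. *)
Lemma derivation_act_kulkarni D E F X1 X2 X3 X4 X Y :
  derivation_act D (kulkarni E F) X1 X2 X3 X4 X Y =
  kulkarni (act2 D E X Y) F X1 X2 X3 X4 + kulkarni E (act2 D F X Y) X1 X2 X3 X4.
Proof. rewrite /derivation_act /kulkarni /act2; ring. Qed.

Lemma derivation_act_tens D a b c d X1 X2 X3 X4 X Y :
  derivation_act D (tens a b c d) X1 X2 X3 X4 X Y =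
  a * derivation_act D (kulkarni (gram_form g) (gram_form g)) X1 X2 X3 X4 X Y
  + b * derivation_act D (kulkarni (gram_form g) (sq_form p)) X1 X2 X3 X4 X Y
  + c * derivation_act D (kulkarni (gram_form g) (sq_form q)) X1 X2 X3 X4 X Y
  + d * derivation_act D (kulkarni (sq_form p) (sq_form q)) X1 X2 X3 X4 X Y.
Proof. rewrite /derivation_act /tens; ring. Qed.

(** The span of the five fixed (0,6)-tensors of the overview. [d] and [d'] separate the two halves
    of the action on the product of [sq_form p] and [sq_form q], whose coefficients may differ. *)
Definition rot_tens (b c d d' m : R) X1 X2 X3 X4 X Y :=
  b * kulkarni (gram_form g) (rot p X Y) X1 X2 X3 X4
  + c * kulkarni (gram_form g) (rot q X Y) X1 X2 X3 X4
  + d * kulkarni (rot p X Y) (sq_form q) X1 X2 X3 X4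
  + d' * kulkarni (sq_form p) (rot q X Y) X1 X2 X3 X4
  + m * kulkarni (gram_form g) (mix X Y) X1 X2 X3 X4.

(** One computation for both [B . T] and [Q(A, T)]: [t] and [u] measure how far [D] fails to
    preserve the metric, [P2] and [Q2] how far it mixes the two covectors. *)
Lemma derivation_actE D a b c d t u P Q P2 Q2 X1 X2 X3 X4 X Y :
  act2 D (gram_form g) X Y = (fun A B => t * rot p X Y A B + u * rot q X Y A B) ->
  act2 D (sq_form p) X Y = (fun A B => P * rot p X Y A B + P2 * mix X Y A B) ->
  act2 D (sq_form q) X Y = (fun A B => Q * rot q X Y A B - Q2 * mix X Y A B) ->
  derivation_act D (tens a b c d) X1 X2 X3 X4 X Y =
  rot_tens (b * P + 2 * a * t) (c * Q + 2 * a * u) (d * P + c * t) (d * Q + b * u)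
    (b * P2 - c * Q2) X1 X2 X3 X4 X Y.
Proof.
move=> Dg Dp Dq; rewrite derivation_act_tens !derivation_act_kulkarni Dg Dp Dq.
(* A symmetric product having a covector as a factor has zero Kulkarni-Nomizu product with the
   square of that covector. *)
have rot_sq x : kulkarni (rot x X Y) (sq_form x) X1 X2 X3 X4 = 0.
  rewrite /kulkarni /rot /sq_form; ring.
have mix_p : kulkarni (mix X Y) (sq_form p) X1 X2 X3 X4 = 0.
  rewrite /kulkarni /mix /sq_form; ring.
have mix_q : kulkarni (mix X Y) (sq_form q) X1 X2 X3 X4 = 0.
  rewrite /kulkarni /mix /sq_form; ring.
have kulkarniC E F : kulkarni E F X1 X2 X3 X4 = kulkarni F E X1 X2 X3 X4.
  rewrite /kulkarni; ring.
have kulkarniD k l E E' F : kulkarni F (fun A B => k * E A B + l * E' A B) X1 X2 X3 X4 =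
    k * kulkarni F E X1 X2 X3 X4 + l * kulkarni F E' X1 X2 X3 X4.
  rewrite /kulkarni; ring.
have kulkarniB k l E E' F : kulkarni F (fun A B => k * E A B - l * E' A B) X1 X2 X3 X4 =
    k * kulkarni F E X1 X2 X3 X4 - l * kulkarni F E' X1 X2 X3 X4.
  rewrite /kulkarni; ring.
have kulkarniDl k l E E' F : kulkarni (fun A B => k * E A B + l * E' A B) F X1 X2 X3 X4 =
    k * kulkarni E F X1 X2 X3 X4 + l * kulkarni E' F X1 X2 X3 X4.
  rewrite /kulkarni; ring.
rewrite /rot_tens !kulkarniDl !kulkarniD !kulkarniB.
rewrite !(kulkarniC (rot _ _ _) (gram_form g)) (kulkarniC (sq_form p) (mix _ _)).
rewrite (kulkarniC (rot q _ _) (sq_form p)) ?(kulkarniC (sq_form p) (rot p _ _)).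
rewrite !rot_sq mix_p mix_q; ring.
Qed.

Lemma dot_tens a b c d a' b' c' d' X1 X2 X3 X4 X Y :
  let P := 2 * a + e * b in let Q := 2 * a + om * c in
  dot g (tens a b c d) (tens a' b' c' d') X1 X2 X3 X4 X Y =
  rot_tens (b' * P) (c' * Q) (d' * P) (d' * Q)
    (b' * (c + e * d) - c' * (b + om * d)) X1 X2 X3 X4 X Y.
Proof.
move=> P Q; have Dop : form_op g (tens a b c d) = tens_op a b c d.
  by do 3!apply/funext => ?; rewrite form_op_tens.
have gS := fun Z W => gram_formC Z W gT.
(* [tens] is skew in its last two arguments, so its operator annihilates the metric: [t = u = 0]. *)
rewrite /dot Dop (@derivation_actE _ _ _ _ _ 0 0 P Q (c + e * d) (b + om * d)).
- by rewrite !mulr0 !addr0.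
- apply/funext => A; apply/funext => B.
  rewrite /act2 /tens_op /sq_form !gram_formE !(gS A); ring.
- apply/funext => A; apply/funext => B.
  rewrite /act2 /rot /mix /tens_op /sq_form !gram_formE pp pq /P; ring.
- apply/funext => A; apply/funext => B.
  rewrite /act2 /rot /mix /tens_op /sq_form !gram_formE qq (gS q p) pq /Q; ring.
Qed.

Lemma tachibana_bform_tens s t u a b c d X1 X2 X3 X4 X Y :
  tachibana (bform s t u) (tens a b c d) X1 X2 X3 X4 X Y =
  rot_tens (s * b - 2 * t * a) (s * c - 2 * u * a) (s * d - t * c) (s * d - u * b)
    (u * b - t * c) X1 X2 X3 X4 X Y.
Proof.
have gS := fun Z W => gram_formC Z W gT.
(* The [s] part of the form gives rotations, which preserve [g]; the rank one parts contribute [- t]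
   and [- u] to the action on [g]. *)
rewrite /tachibana (@derivation_actE _ _ _ _ _ (- t) (- u) s s u t).
- by congr rot_tens; ring.
- apply/funext => A; apply/funext => B.
  rewrite /act2 /wedge_op /bform /rot /sq_form !gram_formE !(gS A); ring.
- apply/funext => A; apply/funext => B.
  rewrite /act2 /wedge_op /bform /sq_form /rot /mix !gram_formE; ring.
- apply/funext => A; apply/funext => B.
  rewrite /act2 /wedge_op /bform /sq_form /rot /mix !gram_formE; ring.
Qed.

Lemma tachibana_gram_tens a b c d X1 X2 X3 X4 X Y :
  tachibana (gram_form g) (tens a b c d) X1 X2 X3 X4 X Y =
  rot_tens b c d d 0 X1 X2 X3 X4 X Y.
Proof.
have -> : gram_form g = bform 1 0 0.
  by apply/funext => A; apply/funext => B; rewrite /bform; ring.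
rewrite tachibana_bform_tens; congr rot_tens; ring.
Qed.

End Tensor.

(** * Ricci and Weyl tensors and the three identities at one point *)

Section Point.
Context {R : realType} {n : nat} (W : semiRiemannian R n) (x : W).
Local Notation V := 'rV[R]_n.

Lemma coord_cod : chart_cod (atlas W (base_chart W x)) (Defs.coord x).
Proof. by apply: chart_mapP; apply: base_chartP. Qed.

Lemma gram_sym : (gram x)^T = gram x.
Proof. exact: (Defs.metric_sym coord_cod). Qed.

Lemma gram_unit : gram x \in unitmx.
Proof. exact: (metric_nondegenerate coord_cod). Qed.

Variables (p q : V) (e om a b c : R).
Hypotheses (n_ge3 : (3 <= n)%N) (e1 : e = 1 \/ e = -1).
Hypotheses (pp : metric_form x p p = e) (pq : metric_form x p q = 0).
Hypothesis qq : metric_form x q q = om.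
Hypothesis riemannE : riemann x = tens (gram x) p q a b c (- (e * c)).

(** Coefficients of the Ricci tensor, read from [endo_trace_tens] with last coefficient [- (e * c)].
    Since [e ^+ 2 = 1], the third is [(n - 2) c - c], whence the factor [n - 3] in [u]. [mu] is the
    third coefficient of the Weyl tensor. *)
Let s := 2 * (n%:R - 1) * a + e * b + om * c.
Let t := (n%:R - 2) * b - om * e * c.
Let u := (n%:R - 3) * c.
Let mu := c / (n%:R - 2).
Let n1 : n%:R - 1 != 0 :> R.
Proof. by rewrite subr_eq0 pnatr_eq1; case: n n_ge3 => [|[|[]]]. Qed.
Let n2 : n%:R - 2 != 0 :> R.
Proof. by rewrite subr_eq0 eqr_nat; case: n n_ge3 => [|[|[]]]. Qed.

Lemma riemann_op_tens X Y Z :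
  riemann_op x X Y Z = tens_op (gram x) p q a b c (- (e * c)) X Y Z.
Proof.
apply: (gram_form_inj gram_unit) => U.
by rewrite gram_tens_op -riemannE.
Qed.

Lemma ricci_tens : ricci x = bform (gram x) p q s t u.
Proof.
apply/funext => X; apply/funext => Y; rewrite /ricci.
rewrite (_ : (fun Z => _) = fun Z => tens_op (gram x) p q a b c (- (e * c)) Z X Y).
  rewrite (endo_trace_tens gram_sym pp pq qq) /s /t /u.
  by case: e1 => ->; congr bform; ring.
by apply/funext => Z; rewrite riemann_op_tens.
Qed.

Lemma ricci_op_tens X : ricci_op x X = bop (gram x) p q s t u X.
Proof. by rewrite /ricci_op ricci_tens sharp_bform //; apply: gram_unit. Qed.

Lemma scalar_curvature_tens : scalar_curvature x = s * n%:R + t * e + u * om.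
Proof.
rewrite /scalar_curvature (_ : ricci_op x = bop (gram x) p q s t u).
  by rewrite (endo_trace_bform pp qq).
by apply/funext => X; rewrite ricci_op_tens.
Qed.

Lemma ricci2_tens : ricci2 x =
  bform (gram x) p q (s ^+ 2) (2 * s * t + e * t ^+ 2) (2 * s * u + om * u ^+ 2).
Proof.
apply/funext => X; apply/funext => Y.
by rewrite /ricci2 ricci_op_tens ricci_tens (bform_bop gram_sym pp pq qq).
Qed.

(** Removing traces keeps the last coefficient [- (e * c)] and turns [c] into
    [c - u / (n - 2) = mu]. The first two are then forced by the vanishing of the trace, so [a] and
    [b] disappear and all coefficients are multiples of [c]. *)
Lemma weyl_tens : weyl x = tens (gram x) p q
  (- mu * om / (n%:R - 1)) (mu * e * om) mu (- (n%:R - 2) * mu * e).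
Proof.
do 4!apply/funext => ?; rewrite /weyl riemannE ricci_tens kulkarni_gram_bform.
rewrite scalar_curvature_tens /metric_G.
rewrite /tens /mu /s /t /u -/(metric_form x).
by case: e1 => ->; field; rewrite n1 n2.
Qed.

(** [Q(g, C)] has no [mix] part, so the [mix] coefficients balance without it: they cancel in
    [R.R - Q(S, R)], vanish in [C.C], and in the third identity agree with that of [Q(S, C)]. [L]
    and [LC] are the proportionality factors of the other four coefficients in the first two
    identities. *)
Lemma warped_identities X1 X2 X3 X4 X Y :
  let L := - (n%:R - 2) * (2 * a + e * b) in
  let LC := (n%:R - 3) * mu * om / (n%:R - 1) in
  [/\ dot (gram x) (riemann x) (riemann x) X1 X2 X3 X4 X Y
      - tachibana (ricci x) (riemann x) X1 X2 X3 X4 X Y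
      = L * tachibana (metric_form x) (weyl x) X1 X2 X3 X4 X Y,
      dot (gram x) (weyl x) (weyl x) X1 X2 X3 X4 X Y
      = LC * tachibana (metric_form x) (weyl x) X1 X2 X3 X4 X Y
    & dot (gram x) (weyl x) (riemann x) X1 X2 X3 X4 X Y
      + dot (gram x) (riemann x) (weyl x) X1 X2 X3 X4 X Y
      = tachibana (ricci x) (weyl x) X1 X2 X3 X4 X Y
        + (L + LC) * tachibana (metric_form x) (weyl x) X1 X2 X3 X4 X Y
        - ((n%:R - 2) ^+ 2)^-1 * tachibana (metric_form x)
            (fun Y1 Y2 Y3 Y4 =>
              (n%:R - 2) / 2 * kulkarni (ricci x) (ricci x) Y1 Y2 Y3 Y4
              - scalar_curvature x
                * kulkarni (metric_form x) (ricci x) Y1 Y2 Y3 Y4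
              + kulkarni (metric_form x) (ricci2 x) Y1 Y2 Y3 Y4)
            X1 X2 X3 X4 X Y].
Proof.
move=> L LC.
have T3E : (fun Y1 Y2 Y3 Y4 : V =>
      (n%:R - 2) / 2 * kulkarni (ricci x) (ricci x) Y1 Y2 Y3 Y4
      - scalar_curvature x * kulkarni (metric_form x) (ricci x) Y1 Y2 Y3 Y4
      + kulkarni (metric_form x) (ricci2 x) Y1 Y2 Y3 Y4) =
    tens (gram x) p q
      ((n%:R - 2) / 2 * s ^+ 2 - (s * n%:R + t * e + u * om) * s + s ^+ 2)
      ((n%:R - 2) * s * t - (s * n%:R + t * e + u * om) * t + 2 * s * t + e * t ^+ 2)
      ((n%:R - 2) * s * u - (s * n%:R + t * e + u * om) * u + 2 * s * u + om * u ^+ 2)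
      ((n%:R - 2) * t * u).
  rewrite ricci_tens ricci2_tens scalar_curvature_tens.
  do 4!apply/funext => ?; rewrite kulkarni_bform !kulkarni_gram_bform /tens.
  by field.
rewrite T3E weyl_tens riemannE ricci_tens.
have dotE := dot_tens gram_sym gram_unit pp pq qq.
have tachE := tachibana_bform_tens p q gram_sym.
have tachgE := tachibana_gram_tens p q gram_sym.
rewrite !dotE !tachE !tachgE /rot_tens /L /LC /s /t /u /mu.
(* The two signs of [e] are treated separately so that [e ^+ 2 = 1] holds by computation. *)
split.
- by case: e1 => ->; field.
- by case: e1 => ->; field; rewrite n1 n2.
- by case: e1 => ->; field; rewrite n1 n2.
Qed.
End Point.

(** * Levi-Civita connection in a chart *)

Section Calculus.
Context {R : realType} {V : normedModType R}.
Implicit Types (x v : V).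

Lemma is_derive_mx m n (A : V -> 'M[R]_(m, n)) (dA : 'M[R]_(m, n)) x v :
  (forall i j, is_derive x v (fun y => A y i j) (dA i j)) -> is_derive x v A dA.
Proof.
move=> AdA; have dvA : derivable A x v.
  by apply/derivable_mxP => i j; apply: ex_derive.
by split=> //; rewrite derive_mx //; apply/matrixP => i j; rewrite mxE derive_val.
Qed.

Lemma is_derive_mxE m n (A : V -> 'M[R]_(m, n)) (dA : 'M[R]_(m, n)) x v i j :
  is_derive x v A dA -> is_derive x v (fun y => A y i j) (dA i j).
Proof.
move=> AdA; have dvA : derivable A x v by apply: ex_derive.
split; first by move/derivable_mxP: dvA.
by have := @derive_val _ _ _ _ _ _ _ AdA; rewrite derive_mx // => <-; rewrite mxE.
Qed.

Lemma is_derive_sumE (I : Type) (r : seq I) (f : I -> V -> R) df x v :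
  (forall i, is_derive x v (f i) (df i)) ->
  is_derive x v (fun y => \sum_(i <- r) f i y) (\sum_(i <- r) df i).
Proof.
move=> fdf; elim: r => [|i r IH].
  rewrite (_ : (fun y => _) = cst 0); first by rewrite big_nil; apply: is_derive_cst.
  by apply/funext => y; rewrite big_nil.
rewrite (_ : (fun y => _) = f i + (fun y => \sum_(i <- r) f i y)).
  by rewrite big_cons; apply: is_deriveD.
by apply/funext => y; rewrite big_cons.
Qed.

Lemma is_derive_mulmx m n l (A : V -> 'M[R]_(m, n)) (B : V -> 'M[R]_(n, l))
    (dA : 'M[R]_(m, n)) (dB : 'M[R]_(n, l)) x v :
  is_derive x v A dA -> is_derive x v B dB ->
  is_derive x v (fun y => A y *m B y) (dA *m B x + A x *m dB).
Proof.
move=> AdA BdB; apply: is_derive_mx => i k.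
rewrite (_ : (fun y => _) = fun y => \sum_j A y i j * B y j k); last first.
  by apply/funext => y; rewrite mxE.
rewrite !mxE -big_split /=; apply: is_derive_sumE => j.
apply: is_derive_eq; first by apply: is_deriveM; apply: is_derive_mxE; eassumption.
by rewrite addrC [X in _ + X]mulrC.
Qed.

Lemma is_derive_row_mx m n l (A : V -> 'M[R]_(m, n)) (B : V -> 'M[R]_(m, l))
    (dA : 'M[R]_(m, n)) (dB : 'M[R]_(m, l)) x v :
  is_derive x v A dA -> is_derive x v B dB ->
  is_derive x v (fun y => row_mx (A y) (B y)) (row_mx dA dB).
Proof.
move=> AdA BdB; apply: is_derive_mx => i k; case: (split_ordP k) => j ->.
  rewrite row_mxEl (_ : (fun y => _) = fun y => A y i j); first exact: is_derive_mxE.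
  by apply/funext => y; rewrite row_mxEl.
rewrite row_mxEr (_ : (fun y => _) = fun y => B y i j); first exact: is_derive_mxE.
by apply/funext => y; rewrite row_mxEr.
Qed.

Lemma differentiable_bigsum (I : Type) (r : seq I) (P : pred I) (f : I -> V -> R) x :
  (forall i, differentiable (f i) x) ->
  differentiable (fun y => \sum_(i <- r | P i) f i y) x.
Proof.
move=> df; elim: r => [|i r IH].
  rewrite (_ : (fun y => _) = cst 0); first exact: differentiable_cst.
  by apply/funext => y; rewrite big_nil.
have [Pi|Pi] := boolP (P i).
  rewrite (_ : (fun y => _) = f i + (fun y => \sum_(i <- r | P i) f i y)).
    exact: differentiableD.
  by apply/funext => y; rewrite big_cons Pi.
rewrite (_ : (fun y => _) = (fun y => \sum_(i <- r | P i) f i y)) //.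
by apply/funext => y; rewrite big_cons (negbTE Pi).
Qed.

Lemma differentiable_bigprod (I : Type) (r : seq I) (f : I -> V -> R) x :
  (forall i, differentiable (f i) x) -> differentiable (fun y => \prod_(i <- r) f i y) x.
Proof.
move=> df; elim: r => [|i r IH].
  rewrite (_ : (fun y => _) = cst 1); first exact: differentiable_cst.
  by apply/funext => y; rewrite big_nil.
rewrite (_ : (fun y => _) = f i * (fun y => \prod_(i <- r) f i y)).
  exact: differentiableM.
by apply/funext => y; rewrite big_cons.
Qed.

Lemma differentiable_det n (A : V -> 'M[R]_n) x :
  (forall i j, differentiable (fun y => A y i j) x) ->
  differentiable (fun y => \det (A y)) x.
Proof.
move=> dA; apply: differentiable_bigsum => s.
by apply: (differentiableM (differentiable_cst _ _)); apply: differentiable_bigprod.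
Qed.

Lemma differentiable_invmx n (A : V -> 'M[R]_n) x :
  (forall i j, differentiable (fun y => A y i j) x) ->
  (\near x, A x \in unitmx) ->
  forall i j, differentiable (fun y => invmx (A y) i j) x.
Proof.
move=> dA uA i j.
(* Cramer's rule. [invmx] returns its argument on a singular matrix, so the formula is used only
   near [x], where [A] is invertible. *)
apply: (@near_eq_differentiable _ _ _ (fun y => (\det (A y))^-1 * cofactor (A y) j i)).
  apply: filterS uA => y uAy; rewrite /invmx uAy !mxE; by [].
have dV : differentiable (fun y => (\det (A y))^-1) x.
  apply: differentiableV; first exact: differentiable_det.
  by have := nbhs_singleton uA; rewrite unitmxE unitfE.
apply: (differentiableM dV); rewrite /cofactor.
apply: (differentiableM (differentiable_cst _ _)).
apply: differentiable_det => k l.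
rewrite (_ : (fun y => _) = fun y => A y (lift j k) (lift i l)) //.
by apply/funext => y; rewrite !mxE.
Qed.

End Calculus.

(** [sharp] reads [a] on the standard basis only; linearity carries the equation to every [w]. *)
Lemma gram_sharp (R : realType) n (g : 'M[R]_n) (a : 'rV[R]_n -> R) w :
  g \in unitmx -> (forall k x y, a (k *: x + y) = k * a x + a y) ->
  gram_form g (sharp g a) w = a w.
Proof.
move=> gU alin; have a0 : a 0 = 0.
  by have := alin (- 1) 0 0; rewrite scaler0 addr0 mulN1r addNr.
have aD x y : a (x + y) = a x + a y by rewrite -{1}[x]scale1r alin mul1r.
rewrite /gram_form /sharp mulmxKV // [in RHS](row_sum_delta w) (big_morph a aD a0) mxE.
by apply: eq_bigr => j _; rewrite -[_ *: _]addr0 alin a0 addr0 !mxE mulrC.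
Qed.

Lemma gram_form_linear (R : realType) n (g h : 'M[R]_n) k x y :
  gram_form (k *: g + h) x y = k * gram_form g x y + gram_form h x y.
Proof. by rewrite /gram_form mulmxDr mulmxDl -scalemxAr -scalemxAl !mxE. Qed.

Section LeviCivita.
Context {R : realType} {n : nat} (M : semiRiemannian R n) (i : chart_index M).
Local Notation V := 'rV[R]_n.
Local Notation H := (metric M i).
Local Notation U := (chart_cod (atlas M i)).
Implicit Types (y u v w : V).

(* [locked] here and below keeps unification from unfolding derivatives. *)
Definition dmetric : V -> V -> 'M[R]_n :=
  locked (fun u y => \matrix_(k, l) 'D_u (fun z => H z k l) y).

Lemma dmetricE u y k l : dmetric u y k l = 'D_u (fun z => H z k l) y.
Proof. by rewrite /dmetric -lock mxE. Qed.

Definition conn : V -> V -> V -> V := locked (christoffel H).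

Lemma connE : christoffel H = conn.
Proof. by rewrite /conn -lock. Qed.

Lemma metric_differentiable y k l : U y -> differentiable (fun z => H z k l) y.
Proof. by move=> Uy; apply: smooth_on_diff Uy; apply: metric_smooth. Qed.

Lemma near_cod y : U y -> \near y, U y.
Proof. by move=> Uy; apply: open_nbhs_nbhs; split => //; apply: chart_cod_open. Qed.

Lemma is_derive_gram_metric y u v w : U y ->
  is_derive y u (fun z => gram_form (H z) v w) (gram_form (dmetric u y) v w).
Proof.
move=> Uy; apply: is_derive_mxE.
have -> : v *m dmetric u y *m w^T =
    (0 *m H y + v *m dmetric u y) *m w^T + (v *m H y) *m 0.
  by rewrite mul0mx mulmx0 add0r addr0.
apply: (@is_derive_mulmx _ _ _ _ _ (fun z => v *m H z) (cst w^T)).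
  apply: (@is_derive_mulmx _ _ _ _ _ (cst v) H).
  apply: is_derive_mx => k l; rewrite dmetricE; apply/derivableP/diff_derivable.
  exact: metric_differentiable.
Qed.

Lemma derive_gram_metric y u v w : U y ->
  'D_u (fun z => gram_form (H z) v w) y = gram_form (dmetric u y) v w.
Proof. by move=> /is_derive_gram_metric ?; apply: derive_val. Qed.

Lemma dmetric_linear y k u v : U y ->
  dmetric (k *: u + v) y = k *: dmetric u y + dmetric v y.
Proof.
move=> Uy; apply/matrixP => a b; rewrite !mxE !dmetricE !deriveE ?linearP //;
  exact: metric_differentiable.
Qed.

Lemma dmetric_sym y u : U y -> (dmetric u y)^T = dmetric u y.
Proof.
move=> Uy; apply/matrixP => a b; rewrite mxE !dmetricE; apply: near_eq_derive.
apply: filterS (near_cod Uy) => z Uz.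
by rewrite -[in LHS](Defs.metric_sym Uz) mxE.
Qed.

Lemma koszul y u v w : U y -> gram_form (H y) (conn y u v) w =
  2^-1 * (gram_form (dmetric u y) v w + gram_form (dmetric v y) u w
          - gram_form (dmetric w y) u v).
Proof.
move=> Uy; rewrite -connE /christoffel gram_sharp; first by rewrite !derive_gram_metric.
  exact: metric_nondegenerate Uy.
move=> k a b; rewrite !derive_gram_metric // dmetric_linear //.
by rewrite !gram_formDr !gram_formZr gram_form_linear; ring.
Qed.

Lemma connC y u v : U y -> conn y u v = conn y v u.
Proof.
move=> Uy; apply: (gram_form_inj (metric_nondegenerate Uy)) => w.
by rewrite !koszul // (gram_formC u v (dmetric_sym _ Uy)); ring.
Qed.

Lemma conn_linear y k u u' v : U y ->
  conn y (k *: u + u') v = k *: conn y u v + conn y u' v.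
Proof.
move=> Uy; apply: (gram_form_inj (metric_nondegenerate Uy)) => w.
rewrite gram_formDl gram_formZl !koszul // dmetric_linear // gram_form_linear.
by rewrite !gram_formE; ring.
Qed.

Lemma conn0l y v : U y -> conn y 0 v = 0.
Proof.
move=> Uy; have := conn_linear (-1) 0 0 v Uy.
by rewrite scaler0 addr0 scaleN1r addNr.
Qed.

Lemma connDl y u u' v : U y -> conn y (u + u') v = conn y u v + conn y u' v.
Proof. by move=> Uy; rewrite -{1}[u]scale1r conn_linear // scale1r. Qed.

Lemma connZl y k u v : U y -> conn y (k *: u) v = k *: conn y u v.
Proof. by move=> Uy; rewrite -[k *: u]addr0 conn_linear // conn0l ?addr0. Qed.

Lemma connDr y u v v' : U y -> conn y u (v + v') = conn y u v + conn y u v'.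
Proof. by move=> Uy; rewrite connC // connDl // !(connC u). Qed.

Lemma connZr y k u v : U y -> conn y u (k *: v) = k *: conn y u v.
Proof. by move=> Uy; rewrite connC // connZl // (connC u). Qed.

(** The sum of two instances of Koszul's formula, with [v] and [w] exchanged, in which only the
    derivatives along [u] survive. *)
Lemma metric_compatible y u v w : U y ->
  gram_form (dmetric u y) v w =
  gram_form (H y) (conn y u v) w + gram_form (H y) v (conn y u w).
Proof.
move=> Uy; rewrite (gram_formC v _ (Defs.metric_sym Uy)) !koszul //.
have dC a := gram_formC _ _ (dmetric_sym a Uy).
by rewrite (dC v w) (dC u w) (dC w v); field.
Qed.

(** A Christoffel vector is a row of first derivatives of the metric times the inverse Gram matrix;
    smoothness of the metric handles the former, [differentiable_invmx] the latter. *)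
Lemma conn_differentiable y v w k : U y ->
  differentiable (fun z => conn z v w 0 k) y.
Proof.
move=> Uy.
have grad a b c z : U z -> differentiable (fun z => 'D_a (fun y => gram_form (H y) b c) z) z.
  move=> Uz; apply: (@near_eq_differentiable _ _ _ (fun z => gram_form (dmetric a z) b c)).
    by apply: filterS (near_cod Uz) => t Ut; rewrite derive_gram_metric.
  have -> : (fun z => gram_form (dmetric a z) b c) = fun z =>
      \sum_(l < n) (\sum_(j < n) b 0 j * 'D_a (fun z => H z j l) z) * c 0 l.
    apply/funext => t; rewrite /gram_form mxE; apply: eq_bigr => l _.
    by rewrite mxE; congr (_ * _); [apply: eq_bigr => j _; rewrite dmetricE|rewrite mxE].
  apply: differentiable_bigsum => l.
  apply: (differentiableM _ (differentiable_cst _ _)).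
  apply: differentiable_bigsum => j.
  apply: (differentiableM (differentiable_cst _ _)).
  exact: smooth_on_diff (smooth_on_derive _ (@metric_smooth _ _ M i j l)) Uz.
rewrite (_ : (fun z => _) = fun z => \sum_(j < n) (2^-1 * (
    'D_v (fun y => gram_form (H y) w (delta_mx 0 j)) z
    + 'D_w (fun y => gram_form (H y) v (delta_mx 0 j)) z
    - 'D_(delta_mx 0 j) (fun y => gram_form (H y) v w) z)) * invmx (H z) j k).
  apply: differentiable_bigsum => j.
  have dinv : differentiable (fun z => invmx (H z) j k) y.
    apply: differentiable_invmx => [a b|]; first exact: metric_differentiable.
    by apply: filterS (near_cod Uy) => z Uz; apply: metric_nondegenerate.
  apply: (differentiableM _ dinv); apply: (differentiableM (differentiable_cst _ _)).
  by apply: differentiableB; [apply: differentiableD|]; apply: grad.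
apply/funext => z; rewrite -connE /christoffel /sharp mxE; apply: eq_bigr => j _.
by rewrite mxE.
Qed.

Lemma conn_derivable y u v w : U y -> derivable (fun z => conn z v w) y u.
Proof.
move=> Uy; apply/derivable_mxP => a k; rewrite ord1.
exact/diff_derivable/conn_differentiable.
Qed.

Definition dconn : V -> V -> V -> V -> V :=
  locked (fun u v w y => 'D_u (fun z => conn z v w) y).

Lemma dconnE u v w y : dconn u v w y = 'D_u (fun z => conn z v w) y.
Proof. by rewrite /dconn -lock. Qed.

Lemma is_derive_conn y u v w : U y ->
  is_derive y u (fun z => conn z v w) (dconn u v w y).
Proof. by move=> Uy; rewrite dconnE; apply/derivableP/conn_derivable. Qed.

Lemma dconnC y u v w : U y -> dconn u v w y = dconn u w v y.
Proof.
move=> Uy; rewrite !dconnE; apply: near_eq_derive.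
by apply: filterS (near_cod Uy) => z Uz; apply: connC.
Qed.

Lemma dconn_linear1 y k u u' v w : U y ->
  dconn (k *: u + u') v w y = k *: dconn u v w y + dconn u' v w y.
Proof.
move=> Uy; rewrite !dconnE !derive_mx; try exact: conn_derivable.
apply/matrixP => a b; rewrite !mxE ord1 !deriveE ?linearP //;
  exact: conn_differentiable.
Qed.

Lemma dconn_linear2 y k u v v' w : U y ->
  dconn u (k *: v + v') w y = k *: dconn u v w y + dconn u v' w y.
Proof.
move=> Uy; have [d1 d2] := (is_derive_conn u v w Uy, is_derive_conn u v' w Uy).
rewrite -(@derive_val _ _ _ _ _ _ _ (is_deriveD (is_deriveZ k d1) d2)) dconnE.
apply: near_eq_derive; apply: filterS (near_cod Uy) => z Uz.
by rewrite connDl // connZl.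
Qed.

(** Constant fields commute, so the bracket term vanishes and the classical expression in
    Christoffel symbols remains. *)
Lemma curvature_atE y u v w : U y -> curvature_at H y u v w =
  dconn u v w y - dconn v u w y
  + conn y u (conn y v w) - conn y v (conn y u w).
Proof.
move=> Uy; have nablaE a b : nabla H (cst a) (cst b) = fun z => conn z a b.
  by apply/funext => z; rewrite /nabla derive_cst add0r connE.
rewrite /curvature_at /curvature !nablaE.
have -> : nabla H (lie_bracket (cst u) (cst v)) (cst w) y = 0.
  rewrite /nabla derive_cst add0r connE (_ : lie_bracket _ _ y = 0) ?conn0l //.
  by rewrite /lie_bracket !derive_cst subr0.
rewrite /nabla /= connE -!dconnE subr0 opprD !addrA; congr (_ - _).
by rewrite addrAC.
Qed.

Lemma curvature_atN y u v w : U y -> curvature_at H y u v w = - curvature_at H y v u w.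
Proof. by move=> Uy; rewrite !curvature_atE // !opprD !opprK; apply/rowP => k; rewrite !mxE; ring. Qed.

Lemma curvature_at_linear1 y k u u' v w : U y ->
  curvature_at H y (k *: u + u') v w =
  k *: curvature_at H y u v w + curvature_at H y u' v w.
Proof.
move=> Uy; rewrite !curvature_atE // dconn_linear1 // dconn_linear2 //.
rewrite !connDl // !connZl // !connDr // !connZr //.
by apply/rowP => j; rewrite !mxE; ring.
Qed.

Lemma curvature_at_linear3 y k u v w w' : U y ->
  curvature_at H y u v (k *: w + w') =
  k *: curvature_at H y u v w + curvature_at H y u v w'.
Proof.
move=> Uy; rewrite !curvature_atE // !(dconnC _ _ (k *: w + w')) //.
rewrite !dconn_linear2 // !(dconnC _ _ w) // !(dconnC _ _ w') //.
rewrite !connDr // !connZr //.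
by apply/rowP => j; rewrite !mxE; ring.
Qed.

(** By the symmetry of [conn] and [dconn] in their last two vectors, the terms of the cyclic sum
    cancel in pairs. *)
Lemma curvature_at_bianchi y u v w : U y ->
  curvature_at H y u v w + curvature_at H y v w u + curvature_at H y w u v = 0.
Proof.
move=> Uy; rewrite !curvature_atE //.
rewrite (dconnC v u w) // (dconnC w v u) // (dconnC u w v) //.
rewrite (connC u w) // (connC v u) // (connC w v) //.
by apply/rowP => j; rewrite !mxE; ring.
Qed.

End LeviCivita.

(** * Quasi-Einstein conformally flat manifolds *)

Lemma form2_mxE (R : realType) n (A : form2 R n) X Y :
  (forall k X X' Y, A (k *: X + X') Y = k * A X Y + A X' Y) ->
  (forall k X Y Y', A X (k *: Y + Y') = k * A X Y + A X Y') ->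
  A X Y = gram_form (form2_mx A) X Y.
Proof.
move=> Al Ar; have A0l Z : A 0 Z = 0.
  by have := Al (- 1) 0 0 Z; rewrite scaler0 addr0 mulN1r addNr.
have A0r Z : A Z 0 = 0.
  by have := Ar (- 1) Z 0 0; rewrite scaler0 addr0 mulN1r addNr.
have ADl Z : {morph A^~ Z : x y / x + y} by move=> x y; rewrite -{1}[x]scale1r Al mul1r.
have ADr Z : {morph A Z : x y / x + y} by move=> x y; rewrite -{1}[x]scale1r Ar mul1r.
rewrite {1}(row_sum_delta X) (big_morph (A^~ Y) (ADl Y) (A0l Y)) /gram_form -mulmxA mxE.
apply: eq_bigr => i _; rewrite -[_ *: _]addr0 Al A0l addr0; congr (_ * _).
rewrite {1}(row_sum_delta Y) (big_morph (A _) (ADr _) (A0r _)) mxE.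
by apply: eq_bigr => j _; rewrite -[_ *: _]addr0 Ar A0r addr0 [form2_mx A _ _]mxE [Y^T _ _]mxE mulrC.
Qed.

(** Rank one gives [A = x^T *m y], and symmetry makes [x] proportional to [y]. The factor [k] stays
    outside because it may fail to be a square. *)
Lemma rank1_symP (F : fieldType) n (A : 'M[F]_n) : A^T = A -> \rank A = 1%N ->
  exists k (y : 'rV_n), A = k *: (y^T *m y).
Proof.
move=> AT rA; have [x [y Axy]] : exists x y : 'rV_n, A = x^T *m y.
  have := mulmx_base A; move: (col_base A) (row_base A); rewrite rA => C D <-.
  by exists C^T, D; rewrite trmxK.
have Aij i j : A i j = x 0 i * y 0 j by rewrite Axy mxE big_ord1 mxE.
have [y0|] := eqVneq y 0.
  by move: rA; rewrite Axy y0 mulmx0 mxrank0.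
case/rV0Pn => j yj; exists (x 0 j / y 0 j), y; apply/matrixP => a b.
have Aja : x 0 a * y 0 j = x 0 j * y 0 a by rewrite -!Aij -[in LHS]AT mxE.
rewrite Aij mxE [(_ *m _) _ _]mxE big_ord1 mxE.
by rewrite -[x 0 a](mulfK yj) Aja; field.
Qed.

Section RicciSymmetry.
Context {R : realType} {n : nat} (M : semiRiemannian R n) (x : M).
Hypothesis n_ge3 : (3 <= n)%N.
Hypothesis weyl0 : forall X1 X2 X3 X4, weyl x X1 X2 X3 X4 = 0.
Implicit Types X Y Z : 'rV[R]_n.

Let n2 : n%:R - 2 != 0 :> R.
Proof. by rewrite subr_eq0 eqr_nat; case: n n_ge3 => [|[|[]]]. Qed.
Let n1 : n%:R - 1 != 0 :> R.
Proof. by rewrite subr_eq0 pnatr_eq1; case: n n_ge3 => [|[|[]]]. Qed.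

Lemma ricci_linearr k X Y Y' : ricci x X (k *: Y + Y') = k * ricci x X Y + ricci x X Y'.
Proof.
rewrite /ricci -endo_traceZ -endo_traceD; congr endo_trace; apply/funext => Z.
by rewrite /riemann_op curvature_at_linear3 //; apply: coord_cod.
Qed.

Lemma ricci_linearl k X X' Y : ricci x (k *: X + X') Y = k * ricci x X Y + ricci x X' Y.
Proof.
rewrite /ricci -endo_traceZ -endo_traceD; congr endo_trace; apply/funext => Z.
have cx := coord_cod x; rewrite /riemann_op !(curvature_atN Z) //.
by rewrite curvature_at_linear1 // opprD scalerN.
Qed.

Lemma riemann_bianchi X1 X2 X3 X4 :
  riemann x X1 X2 X3 X4 + riemann x X2 X3 X1 X4 + riemann x X3 X1 X2 X4 = 0.
Proof.
have gram_sum0 a b c : a + b + c = 0 ->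
    gram_form (gram x) a X4 + gram_form (gram x) b X4 + gram_form (gram x) c X4 = 0.
  by move=> abc0; rewrite -!gram_formDl abc0 gram_form0l.
by apply: gram_sum0; apply: curvature_at_bianchi; apply: coord_cod.
Qed.

Lemma conformally_flat_riemann X1 X2 X3 X4 : riemann x X1 X2 X3 X4 =
  (n%:R - 2)^-1 * kulkarni (metric_form x) (ricci x) X1 X2 X3 X4
  - scalar_curvature x / ((n%:R - 2) * (n%:R - 1)) * metric_G x X1 X2 X3 X4.
Proof.
by have /eqP := weyl0 X1 X2 X3 X4; rewrite /weyl addr_eq0 subr_eq addrC => /eqP.
Qed.

(* For a Weyl-free curvature tensor the first Bianchi identity says that
   A(Y, Z) X + A(Z, X) Y + A(X, Y) Z = 0, where A is the skew part of the Ricci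
   tensor; independent X, Y, Z exist, so A = 0. *)
Lemma conformally_flat_ricciC X Y : ricci x X Y = ricci x Y X.
Proof.
pose A X Y := ricci x X Y - ricci x Y X.
have bianchi X1 X2 X3 : A X2 X3 *: X1 + A X3 X1 *: X2 + A X1 X2 *: X3 = 0.
  apply: (gram_form_inj (gram_unit x)) => X4.
  have := riemann_bianchi X1 X2 X3 X4.
  have gC := fun Z W => gram_formC Z W (gram_sym x).
  rewrite !conformally_flat_riemann /metric_G /kulkarni -!/(metric_form x _ _).
  rewrite /metric_form !gram_formDl gram_form0l (gC X2 X1) (gC X3 X1) (gC X3 X2) !gram_formZl /A.
  move: (ricci x) (scalar_curvature x) => S k sum0.
  apply: (mulfI (invr_neq0 n2)).
  by rewrite mulr0 -[RHS]sum0; field; rewrite n1 n2.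
have A0 : forall i j, A (delta_mx 0 i) (delta_mx 0 j) = 0.
  move: A bianchi => A bianchi i j.
  have [k /andP[ki kj]] : exists k : 'I_n, (k != i) && (k != j).
    have [k|ij] := pickP [pred k | (k != i) && (k != j)]; first by exists k.
    have : (size (enum 'I_n) <= size [:: i; j])%N.
      apply: uniq_leq_size; first exact: enum_uniq.
      by move=> k _; have := ij k; rewrite /= !inE; case: eqP => //= _ /negbFE.
    by rewrite size_enum_ord leqNgt n_ge3.
  have /matrixP/(_ 0 k) := bianchi (delta_mx 0 k) (delta_mx 0 i) (delta_mx 0 j).
  by rewrite !mxE !eqxx (negbTE ki) (negbTE kj) /= !mulr0 !addr0 mulr1.
have ricciE := form2_mxE _ _ ricci_linearl ricci_linearr.
rewrite !ricciE; apply: gram_formC; apply/matrixP => i j; rewrite !mxE.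
by apply/eqP; rewrite -subr_eq0; apply/eqP; apply: A0.
Qed.

End RicciSymmetry.

(** With zero Weyl tensor, curvature is determined by the metric and the Ricci tensor, so it
    suffices to split the latter into a multiple of the metric and a multiple of a squared covector.
    A zero second part covers the points outside [ricci_support]. *)
Lemma quasi_einstein_riemann (R : realType) n (N : semiRiemannian R n) (x : N) :
  (3 <= n)%N -> quasi_einstein N -> conformally_flat N ->
  exists a c (q : 'rV[R]_n), forall X1 X2 X3 X4, riemann x X1 X2 X3 X4 =
    a * kulkarni (metric_form x) (metric_form x) X1 X2 X3 X4
    + c * kulkarni (metric_form x) (sq_form (gram x) q) X1 X2 X3 X4.
Proof.
move=> n3 [alpha alphaP] /(_ x) flat.
have ricciC := conformally_flat_ricciC n3 flat.
suff [s [k [q ricciE]]] : exists s k (q : 'rV[R]_n), forall X Y,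
    ricci x X Y = s * metric_form x X Y + k * sq_form (gram x) q X Y.
  (* The last [/ 2] comes from [metric_G] being half of a Kulkarni-Nomizu square. *)
  exists ((n%:R - 2)^-1 * s - scalar_curvature x / ((n%:R - 2) * (n%:R - 1)) / 2).
  exists ((n%:R - 2)^-1 * k), q => X1 X2 X3 X4.
  rewrite (conformally_flat_riemann flat) /metric_G /kulkarni !ricciE.
  by move: (scalar_curvature x / _) (metric_form x) (sq_form _ _) => *; ring.
have [/alphaP rk|einstein] := pselect (ricci_support N x); last first.
  exists (scalar_curvature x / n%:R), 0, 0 => X Y; rewrite mul0r addr0.
  by apply: contrapT => nE; apply: einstein; exists X, Y.
have symA : (form2_mx (ricci x) - alpha x *: gram x)^T =
    form2_mx (ricci x) - alpha x *: gram x.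
  rewrite linearB linearZ /= gram_sym; congr (_ - _).
  by apply/matrixP => i j; rewrite !mxE ricciC.
have [k [y Ay]] := rank1_symP symA rk.
(* The inverse Gram matrix raises the index of the covector [y]. *)
exists (alpha x), k, (y *m invmx (gram x)) => X Y.
have sqE : sq_form (gram x) (y *m invmx (gram x)) X Y = gram_form (y^T *m y) X Y.
  rewrite /sq_form /gram_form !mulmxKV ?gram_unit // !mulmxA -[in RHS]mulmxA.
  rewrite [in RHS]mxE big_ord1; congr (_ * _).
  by rewrite -[X in X *m y^T]trmxK -trmx_mul [RHS]mxE; congr (_ _ _); apply: ord1.
rewrite sqE (form2_mxE _ _ (ricci_linearl x) (ricci_linearr x)).
rewrite -[form2_mx _](subrK (alpha x *: gram x)) Ay gram_form_linear.
rewrite -[_ *: gram x]addr0 gram_form_linear.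
by rewrite [gram_form 0 _ _]/gram_form mulmx0 mul0mx [X in _ + (_ + X)]mxE addr0 addrC.
Qed.

(** * Curvature of the warped product *)

Lemma is_derive_comp_lsubmx (R : realType) p q (W : normedModType R) (f : 'rV[R]_p -> W) df
    v (z : 'rV[R]_(p + q)) :
  is_derive (lsubmx z) (lsubmx v) f df -> is_derive z v (fun z => f (lsubmx z)) df.
Proof.
move=> fdf; split; last by rewrite derive_comp_lsubmx; apply: derive_val.
have := @ex_derive _ _ _ _ _ _ _ fdf; rewrite /derivable.
rewrite (_ : (fun t : R => t^-1 *:
    (((fun z => f (lsubmx z)) \o shift z) (t *: v) - f (lsubmx z))) =
  (fun t : R => t^-1 *:
    ((f \o shift (lsubmx z)) (t *: lsubmx v) - f (lsubmx z)))) //.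
by apply/funext => t /=; rewrite linearP.
Qed.

Lemma is_derive_comp_rsubmx (R : realType) p q (W : normedModType R) (f : 'rV[R]_q -> W) df
    v (z : 'rV[R]_(p + q)) :
  is_derive (rsubmx z) (rsubmx v) f df -> is_derive z v (fun z => f (rsubmx z)) df.
Proof.
move=> fdf; split; last by rewrite derive_comp_rsubmx; apply: derive_val.
have := @ex_derive _ _ _ _ _ _ _ fdf; rewrite /derivable.
rewrite (_ : (fun t : R => t^-1 *:
    (((fun z => f (rsubmx z)) \o shift z) (t *: v) - f (rsubmx z))) =
  (fun t : R => t^-1 *:
    ((f \o shift (rsubmx z)) (t *: rsubmx v) - f (rsubmx z)))) //.
by apply/funext => t /=; rewrite linearP.
Qed.

Lemma is_derive_scalel (R : realType) (V : normedModType R) n (k : V -> R) dk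
    (w : 'rV[R]_n) x v :
  is_derive x v k dk -> is_derive x v (fun y => k y *: w) (dk *: w).
Proof.
move=> kdk; apply: is_derive_mx => i j.
rewrite (_ : (fun y => _) = k * cst (w i j)); last first.
  by apply/funext => y; rewrite mxE.
rewrite mxE; apply: is_derive_eq.
by rewrite scaler0 add0r mulrC.
Qed.

Lemma derive_rV1 (R : realType) (f : 'rV[R]_1 -> R) t s : differentiable f t ->
  'D_s f t = s 0 0 * 'D_(const_mx 1) f t.
Proof.
move=> df; rewrite !deriveE //.
have {1}-> : s = s 0 0 *: const_mx 1 by apply/rowP => k; rewrite ord1 !mxE mulr1.
by rewrite linearZ.
Qed.

Lemma is_derive_half_ratio (R : realType) (V : normedModType R) (k l : V -> R) dk dl x v :
  k x != 0 -> is_derive x v k dk -> is_derive x v l dl ->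
  is_derive x v (fun y => l y / (2 * k y)) (dl / (2 * k x) - l x * dk / (2 * k x ^+ 2)).
Proof.
move=> kx0 kdk ldl.
have kV : is_derive x v (fun y => (k y)^-1) (- (k x) ^- 2 *: dk).
  have dk' : derivable k x v by apply: ex_derive.
  by split; [exact: derivableV|rewrite deriveV // derive_val].
rewrite (_ : (fun y => _) = 2^-1 \*: (l * (fun y => (k y)^-1))).
  by apply: is_derive_eq; rewrite /GRing.scale /=; field.
by apply/funext => y /=; rewrite invfM mulrCA.
Qed.

Lemma gram_form1 (R : realType) (g : 'M[R]_1) x y :
  gram_form g x y = x 0 0 * y 0 0 * g 0 0.
Proof. by rewrite /gram_form !(mxE, big_ord1) !ord1 mulrAC. Qed.

Section WarpedCurvature.
Context {R : realType} {m : nat}.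
Variables (M : semiRiemannian R 1) (N : semiRiemannian R m) (F : M -> R).
Hypotheses (F_smooth : smooth_function F) (F_gt0 : forall a, 0 < F a).
Variables (c : chart_index M) (d : chart_index N) (e : R).
Hypothesis e1 : e = 1 \/ e = -1.
Hypothesis metricM : forall x, chart_cod (atlas M c) x -> metric M c x 0 0 = e.

Local Notation W := (warped_product N F_smooth F_gt0).
Let i : chart_index W := (c, d).
Local Notation V := 'rV[R]_(1 + m).
Local Notation H := (metric N d).
(** The warping function in the base coordinate and its first two derivatives. The Gram entry of the
    base is the constant [e] there, so the base metric contributes no derivative. *)
Let f t := F (chart_inv (atlas M c) t).
Let f1 t := 'D_(const_mx 1) f t.
Let f2 t := 'D_(const_mx 1) f1 t.
Implicit Types u v w z : V.

Let f_smooth : smooth_on (chart_cod (atlas M c)) f.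
Proof. exact: F_smooth. Qed.

Let f1_smooth : smooth_on (chart_cod (atlas M c)) f1.
Proof. exact: smooth_on_derive. Qed.

Let f_neq0 t : f t != 0.
Proof. by rewrite gt_eqF // F_gt0. Qed.

Let codW z : chart_cod (atlas W i) z ->
  chart_cod (atlas M c) (lsubmx z) /\ chart_cod (atlas N d) (rsubmx z).
Proof. by []. Qed.

Lemma gram_warped z u v : chart_cod (atlas M c) (lsubmx z) ->
  gram_form (metric W i z) u v = e * lsubmx u 0 0 * lsubmx v 0 0
    + f (lsubmx z) * gram_form (H (rsubmx z)) (rsubmx u) (rsubmx v).
Proof.
move=> cz; rewrite [LHS]gram_form_warped; congr (_ + _).
by rewrite gram_form1 metricM // mulrC mulrA.
Qed.

Lemma is_derive_base (h : 'rV[R]_1 -> R) z u :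
  smooth_on (chart_cod (atlas M c)) h -> chart_cod (atlas M c) (lsubmx z) ->
  is_derive z u (fun z => h (lsubmx z)) (lsubmx u 0 0 * 'D_(const_mx 1) h (lsubmx z)).
Proof.
move=> sh cz; apply: is_derive_comp_lsubmx.
have dh := smooth_on_diff sh cz.
by rewrite -derive_rV1 //; apply/derivableP/diff_derivable.
Qed.

Lemma dmetric_warped z u v w : chart_cod (atlas W i) z ->
  gram_form (@dmetric _ _ W i u z) v w =
  lsubmx u 0 0 * f1 (lsubmx z) * gram_form (H (rsubmx z)) (rsubmx v) (rsubmx w)
  + f (lsubmx z) * gram_form (dmetric d (rsubmx u) (rsubmx z)) (rsubmx v) (rsubmx w).
Proof.
move=> Wz; have [cz dz] := codW Wz.
rewrite -derive_gram_metric //.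
have := is_derive_base u f_smooth cz; rewrite -/(f1 _) => df.
have := is_derive_comp_rsubmx (is_derive_gram_metric (rsubmx u) (rsubmx v) (rsubmx w) dz).
move=> dH.
have := is_deriveD (is_derive_cst (e * lsubmx v 0 0 * lsubmx w 0 0) z u) (is_deriveM df dH).
move=> /(@derive_val _ _ _ _ _ _ _); rewrite add0r /= => dE.
rewrite (_ : _ + _ = f (lsubmx z) *: gram_form (dmetric d (rsubmx u) (rsubmx z)) (rsubmx v) (rsubmx w)
  + gram_form (H (rsubmx z)) (rsubmx v) (rsubmx w) *: (lsubmx u 0 0 * f1 (lsubmx z))); last first.
  by rewrite addrC [X in _ = _ + X]mulrC.
rewrite -dE; apply: near_eq_derive; apply: filterS (near_cod Wz) => t /codW[ct _].
by rewrite gram_warped.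
Qed.

(** Both sides are paired with an arbitrary [w] and compared by Koszul's formula, on the product and
    on the fibre. In the base component, dividing by [e] is multiplying by [e]. *)
Lemma conn_warped z u v : chart_cod (atlas W i) z ->
  @conn _ _ W i z u v = row_mx
    (const_mx (- (e / 2) * f1 (lsubmx z) * gram_form (H (rsubmx z)) (rsubmx u) (rsubmx v)))
    (conn d (rsubmx z) (rsubmx u) (rsubmx v)
     + (f1 (lsubmx z) / (2 * f (lsubmx z))) *:
        (lsubmx u 0 0 *: rsubmx v + lsubmx v 0 0 *: rsubmx u)).
Proof.
move=> Wz; have [cz dz] := codW Wz.
apply: (gram_form_inj (metric_nondegenerate Wz)) => w.
rewrite koszul // !dmetric_warped // gram_warped // row_mxKl row_mxKr [const_mx _ _ _]mxE.
rewrite !gram_formDl gram_formZl gram_formDl !gram_formZl koszul //.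
have := f_neq0 (lsubmx z).
move: (f (lsubmx z)) (f1 (lsubmx z)) => ft f1t ft0.
by case: e1 => ->; field.
Qed.

(** Coefficients of the connection: [h0] in the base component, [phi], half the logarithmic
    derivative of [f], in the mixed terms; [dphi] is the derivative of [phi]. *)
Let h0 t := - (e / 2) * f1 t.
Let phi t := f1 t / (2 * f t).
Let dphi t := f2 t / (2 * f t) - f1 t ^+ 2 / (2 * f t ^+ 2).

Lemma is_derive_phi z u : chart_cod (atlas M c) (lsubmx z) ->
  is_derive z u (fun z => phi (lsubmx z)) (lsubmx u 0 0 * dphi (lsubmx z)).
Proof.
move=> cz; have df := is_derive_base u f_smooth cz.
have df1 := is_derive_base u f1_smooth cz.
have := @is_derive_half_ratio _ _ (fun z => f (lsubmx z)) _ _ _ _ _ (f_neq0 _) df df1.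
rewrite (_ : _ - _ = lsubmx u 0 0 * dphi (lsubmx z)) //.
rewrite /dphi -/(f1 _) -/(f2 _).
have := f_neq0 (lsubmx z).
by move: (f (lsubmx z)) (f1 (lsubmx z)) (f2 (lsubmx z)) => ft f1t f2t ft0; field.
Qed.

Lemma dconn_warped z u v w : chart_cod (atlas W i) z ->
  @dconn _ _ W i u v w z = row_mx
    (const_mx (- (e / 2) *
      (lsubmx u 0 0 * f2 (lsubmx z) * gram_form (H (rsubmx z)) (rsubmx v) (rsubmx w)
       + f1 (lsubmx z) * gram_form (dmetric d (rsubmx u) (rsubmx z)) (rsubmx v) (rsubmx w))))
    (dconn d (rsubmx u) (rsubmx v) (rsubmx w) (rsubmx z)
     + (lsubmx u 0 0 * dphi (lsubmx z)) *:
        (lsubmx v 0 0 *: rsubmx w + lsubmx w 0 0 *: rsubmx v)).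
Proof.
move=> Wz; have [cz dz] := codW Wz; rewrite dconnE.
have df1 := is_derive_base u f1_smooth cz.
have dH := is_derive_comp_rsubmx
  (is_derive_gram_metric (rsubmx u) (rsubmx v) (rsubmx w) dz).
have dG := is_derive_comp_rsubmx (is_derive_conn (rsubmx u) (rsubmx v) (rsubmx w) dz).
have dP := is_derive_scalel (lsubmx v 0 0 *: rsubmx w + lsubmx w 0 0 *: rsubmx v)
  (is_derive_phi u cz).
have dB := is_deriveD dG dP.
pose A (z : V) : 'M[R]_(1, 1) := const_mx (- (e / 2) * f1 (lsubmx z)
    * gram_form (H (rsubmx z)) (rsubmx v) (rsubmx w)).
have dA : is_derive z u A (const_mx (- (e / 2) *
      (lsubmx u 0 0 * f2 (lsubmx z) * gram_form (H (rsubmx z)) (rsubmx v) (rsubmx w)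
       + f1 (lsubmx z) * gram_form (dmetric d (rsubmx u) (rsubmx z)) (rsubmx v) (rsubmx w)))).
  apply: is_derive_mx => k l; rewrite mxE.
  have := is_deriveZ (- (e / 2)) (is_deriveM df1 dH); rewrite -/(f2 _).
  rewrite (_ : _ *: (_ + _) = - (e / 2) *
      (lsubmx u 0 0 * f2 (lsubmx z) * gram_form (H (rsubmx z)) (rsubmx v) (rsubmx w)
       + f1 (lsubmx z) * gram_form (dmetric d (rsubmx u) (rsubmx z)) (rsubmx v) (rsubmx w))).
    rewrite (_ : _ \*: _ = fun y => A y k l) //.
    by apply/funext => y; rewrite /A mxE -mulrA.
  by congr (_ * _); rewrite addrC; congr (_ + _); apply: mulrC.
rewrite -(@derive_val _ _ _ _ _ _ _ (is_derive_row_mx dA dB)).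
apply: near_eq_derive; apply: filterS (near_cod Wz) => t Wt.
by rewrite conn_warped.
Qed.

Lemma curvature_warped z u v w : chart_cod (atlas W i) z ->
  curvature_at (metric W i) z u v w = row_mx
    (const_mx (- (e / 2) * (f2 (lsubmx z) - f1 (lsubmx z) ^+ 2 / (2 * f (lsubmx z))) *
      (lsubmx u 0 0 * gram_form (H (rsubmx z)) (rsubmx v) (rsubmx w)
       - lsubmx v 0 0 * gram_form (H (rsubmx z)) (rsubmx u) (rsubmx w))))
    (curvature_at H (rsubmx z) (rsubmx u) (rsubmx v) (rsubmx w)
     + ((dphi (lsubmx z) + phi (lsubmx z) ^+ 2) * lsubmx w 0 0) *:
        (lsubmx u 0 0 *: rsubmx v - lsubmx v 0 0 *: rsubmx u)
     + (phi (lsubmx z) * h0 (lsubmx z)) *: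
        (gram_form (H (rsubmx z)) (rsubmx v) (rsubmx w) *: rsubmx u
         - gram_form (H (rsubmx z)) (rsubmx u) (rsubmx w) *: rsubmx v)).
Proof.
move=> Wz; have [cz dz] := codW Wz.
rewrite !curvature_atE // !dconn_warped // !conn_warped // !row_mxKl !row_mxKr.
rewrite !(opp_row_mx, add_row_mx) !mxE.
have := f_neq0 (lsubmx z); rewrite /h0 /phi => ft0.
rewrite !(connDr, connZr) //.
congr row_mx; apply/rowP => k; move: ft0.
  (* Metric compatibility on the fibre rewrites the derivatives of its metric through [conn]; they
     then cancel against the products of connection terms. *)
  rewrite !mxE !gram_formE !metric_compatible // (connC (rsubmx v) (rsubmx u)) //.
  move: (f (lsubmx z)) (f1 (lsubmx z)) => ft f1t ft0.
  have -> := gram_formC (rsubmx v) (rsubmx u) (Defs.metric_sym dz).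
  by field.
rewrite !mxE (connC (rsubmx v) (rsubmx u)) //.
rewrite /dphi; move: (f (lsubmx z)) (f1 (lsubmx z)) (f2 (lsubmx z)) => ft f1t f2t ft0.
by field.
Qed.

(** [f] times the fibre metric equals the warped metric minus [e] times [sq_form p]. Substituting
    this in the curvature of the fibre produces the last coefficient [- (e * k)]. *)
Lemma curvature_warped_tens z a0 k0 (q0 : 'rV[R]_m) : chart_cod (atlas W i) z ->
  (forall X1 X2 X3 X4,
    gram_form (H (rsubmx z)) (curvature_at H (rsubmx z) X1 X2 X3) X4 =
    a0 * kulkarni (gram_form (H (rsubmx z))) (gram_form (H (rsubmx z))) X1 X2 X3 X4
    + k0 * kulkarni (gram_form (H (rsubmx z))) (sq_form (H (rsubmx z)) q0) X1 X2 X3 X4) ->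
  exists a b k (p q : V), [/\ gram_form (metric W i z) p p = e,
    gram_form (metric W i z) p q = 0 &
    forall X1 X2 X3 X4,
      gram_form (metric W i z) (curvature_at (metric W i) z X1 X2 X3) X4 =
      tens (metric W i z) p q a b k (- (e * k)) X1 X2 X3 X4].
Proof.
move=> Wz curvN; have [cz dz] := codW Wz.
pose p : V := row_mx (const_mx 1) 0; pose q : V := row_mx 0 q0.
(* [a] is read off on vectors tangent to the fibre, [b] on planes containing [p], where the two
   terms with [q] cancel. The powers of [f] come from passing between the fibre metric and the
   warped one. *)
pose a := (a0 + phi (lsubmx z) * h0 (lsubmx z) / 2) / f (lsubmx z).
pose b := - 2^-1 * (f2 (lsubmx z) - f1 (lsubmx z) ^+ 2 / (2 * f (lsubmx z)))
  / f (lsubmx z) - 2 * e * a.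
have pl : lsubmx p 0 0 = 1 by rewrite /p row_mxKl mxE.
have ql : lsubmx q 0 0 = 0 by rewrite /q row_mxKl mxE.
have pr : rsubmx p = 0 by rewrite /p row_mxKr.
have qr : rsubmx q = q0 by rewrite /q row_mxKr.
exists a, b, (k0 / f (lsubmx z) ^+ 2), p, q; split.
- by rewrite gram_warped // pl pr gram_form0l mulr0 addr0 !mulr1.
- by rewrite gram_warped // pr ql gram_form0l !mulr0 addr0.
move=> X1 X2 X3 X4; rewrite curvature_warped //.
move: (curvN (rsubmx X1) (rsubmx X2) (rsubmx X3) (rsubmx X4)) => {curvN}.
move: (curvature_at H (rsubmx z) (rsubmx X1) (rsubmx X2) (rsubmx X3)) => r rE.
rewrite /tens /kulkarni /sq_form !gram_warped // row_mxKl row_mxKr [const_mx _ _ _]mxE.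
rewrite pl pr ql qr !gram_formE rE /kulkarni /sq_form /b /a /dphi /phi /h0.
have := f_neq0 (lsubmx z).
move: (f (lsubmx z)) (f1 (lsubmx z)) (f2 (lsubmx z)) => ft f1t f2t ft0.
by case: e1 => ->; field.
Qed.

End WarpedCurvature.

(** * Assembly of the pointwise identities on the warped product *)

Theorem theorem4p3 (R : realType) (n : nat)
    (M : semiRiemannian R 1) (N : semiRiemannian R n.-1)
    (F : M -> R) (F_smooth : smooth_function F) (F_gt0 : forall a, 0 < F a)
    (e : R) :
  (5 <= n)%N ->
  connected_paracompact M -> connected_paracompact N ->
  e = 1 \/ e = -1 ->
  (forall a x, chart_cod (atlas M (base_chart M a)) x ->
    metric M (base_chart M a) x 0 0 = e) ->
  quasi_einstein N -> conformally_flat N ->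
  let W := warped_product N F_smooth F_gt0 in
  exists L LC : W -> R, forall p : W, weyl_support W p ->
  forall X1 X2 X3 X4 X Y : 'rV[R]_(1 + n.-1),
  [/\ dot (gram p) (riemann p) (riemann p) X1 X2 X3 X4 X Y
      - tachibana (ricci p) (riemann p) X1 X2 X3 X4 X Y
      = L p * tachibana (metric_form p) (weyl p) X1 X2 X3 X4 X Y,
      dot (gram p) (weyl p) (weyl p) X1 X2 X3 X4 X Y
      = LC p * tachibana (metric_form p) (weyl p) X1 X2 X3 X4 X Y
    & dot (gram p) (weyl p) (riemann p) X1 X2 X3 X4 X Y
      + dot (gram p) (riemann p) (weyl p) X1 X2 X3 X4 X Y
      = tachibana (ricci p) (weyl p) X1 X2 X3 X4 X Y
        + (L p + LC p) * tachibana (metric_form p) (weyl p) X1 X2 X3 X4 X Y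
        - ((n%:R - 2) ^+ 2)^-1 * tachibana (metric_form p)
            (fun Y1 Y2 Y3 Y4 =>
              (n%:R - 2) / 2 * kulkarni (ricci p) (ricci p) Y1 Y2 Y3 Y4
              - scalar_curvature p
                * kulkarni (metric_form p) (ricci p) Y1 Y2 Y3 Y4
              + kulkarni (metric_form p) (ricci2 p) Y1 Y2 Y3 Y4)
            X1 X2 X3 X4 X Y].
Proof.
move=> n5 _ _ e1 metricM qeN flatN W.
(* Writing [n] as [m.+1] identifies it with the dimension [1 + n.-1] of the product. *)
case: n n5 N qeN flatN @W => [//|m] m4 N qeN flatN W.
have n3 : (3 <= 1 + m)%N by rewrite add1n; apply: leq_trans m4.
have m3 : (3 <= m)%N by apply: leq_trans (m4 : (4 <= m)%N).
(* Pairing the two scalars lets one use of choice produce both functions. *)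
suff /choice[LLC LLCP] : forall p : W, exists LLC : R * R, forall X1 X2 X3 X4 X Y,
  [/\ dot (gram p) (riemann p) (riemann p) X1 X2 X3 X4 X Y
      - tachibana (ricci p) (riemann p) X1 X2 X3 X4 X Y
      = LLC.1 * tachibana (metric_form p) (weyl p) X1 X2 X3 X4 X Y,
      dot (gram p) (weyl p) (weyl p) X1 X2 X3 X4 X Y
      = LLC.2 * tachibana (metric_form p) (weyl p) X1 X2 X3 X4 X Y
    & dot (gram p) (weyl p) (riemann p) X1 X2 X3 X4 X Y
      + dot (gram p) (riemann p) (weyl p) X1 X2 X3 X4 X Y
      = tachibana (ricci p) (weyl p) X1 X2 X3 X4 X Y
        + (LLC.1 + LLC.2) * tachibana (metric_form p) (weyl p) X1 X2 X3 X4 X Y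
        - (((1 + m)%:R - 2) ^+ 2)^-1 * tachibana (metric_form p)
            (fun Y1 Y2 Y3 Y4 =>
              ((1 + m)%:R - 2) / 2 * kulkarni (ricci p) (ricci p) Y1 Y2 Y3 Y4
              - scalar_curvature p
                * kulkarni (metric_form p) (ricci p) Y1 Y2 Y3 Y4
              + kulkarni (metric_form p) (ricci2 p) Y1 Y2 Y3 Y4)
            X1 X2 X3 X4 X Y].
  by exists (fun p => (LLC p).1), (fun p => (LLC p).2) => p _; apply: LLCP.
move=> p; have [a0 [k0 [q0 riemN]]] := quasi_einstein_riemann p.2 m3 qeN flatN.
(* The chosen chart at [p] is the product of those at [p.1] and [p.2], so the fibre curvature is
   taken in matching coordinates. *)
have cp : rsubmx (Defs.coord p) = Defs.coord p.2 by rewrite [LHS]row_mxKr.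
have [|a [b [k [P [Q [PP PQ riemW]]]]]] := curvature_warped_tens (F_smooth := F_smooth) (F_gt0 := F_gt0) e1
   (metricM p.1) (d := base_chart N p.2) (a0 := a0) (k0 := k0) (q0 := q0) (coord_cod p).
  by rewrite cp; exact: riemN.
have riemannE : riemann p = tens (gram p) P Q a b k (- (e * k)).
  by do 4!apply/funext => ?; apply: riemW.
exists (- ((1 + m)%:R - 2) * (2 * a + e * b),
  ((1 + m)%:R - 3) * (k / ((1 + m)%:R - 2)) * metric_form p Q Q / ((1 + m)%:R - 1)).
by move=> X1 X2 X3 X4 X Y; apply: warped_identities n3 e1 PP PQ (erefl _) riemannE _ _ _ _ _ _.
Qed.
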